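(* Assume $u_0(\boldsymbol{x})\ge 0$ and $g(\boldsymbol{x},t)\ge 0$ for all $\boldsymbol{x}$ and $t$. Let $(\boldsymbol{u}^n)_{n\ge 0}$ be generated by the hybrid explicit-implicit scheme (HEIM II) $$(M-\Delta t_n B+\Delta t_n A)\,\boldsymbol{u}^{n+1} = (M+\Delta t_n\,C)\,\boldsymbol{u}^{n}+\Delta t_n\,\boldsymbol{g}^{n+1},\qquad n=0,1,\ldots,$$ where $B=(b_{ij})$ and $C=(c_{ij})$ are the $N_v\times N_v$ matrices (depending on $n$) with $$b_{ij}=\int_\Omega f^{-}(u_h^n)\,\phi_j\phi_i\,d\boldsymbol{x},\qquad c_{ij}=\int_\Omega f^{+}(u_h^n)\,\phi_j\phi_i\,d\boldsymbol{x}$$ for $i=1,\ldots,N_{vi}$, and $b_{ij}=c_{ij}=0$ for $i=N_{vi}+1,\ldots,N_v$ ($j=1,\ldots,N_v$). Suppose that for all $n=0,1,\ldots$ the mesh satisfies $$\mathbb{D}_{acute}>\left(\frac{|\Omega|}{N_e}\right)^{2/d}\frac{\max_{\boldsymbol{x}}\left|f^{-}(u_h^n)\right|}{(d+1)(d+2)}$$ and the time step satisfies $$\Delta t_n\ \ge\ \frac{\left(\frac{|\Omega|}{N_e}\right)^{2/d}}{(d+1)(d+2)\,\mathbb{D}_{acute}-\left(\frac{|\Omega|}{N_e}\right)^{2/d}\max_{\boldsymbol{x}}\left|f^{-}(u_h^n)\right|}.$$ Then the scheme preserves nonnegativity: $u_j^n\ge 0$ for all $j=1,\ldots,N_v$ and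 all $n\ge 0$ (equivalently, $u_h^n\ge 0$ on $\Omega$ for all $n\ge 0$).
   Context: Continuous problem: $\partial_t u-\nabla\cdot(\mathbb{D}\nabla u)=u f(u)$ in $\Omega\times(0,T]$, $u=g$ on $\partial\Omega\times(0,T]$, $u(\cdot,0)=u_0$ in $\Omega$. Here $d\in\{1,2,3\}$, $\Omega\subset\mathbb{R}^d$ is a connected bounded polygonal or polyhedral domain, $T>0$; the diffusion tensor $\mathbb{D}=\mathbb{D}(\boldsymbol{x})$ is a $d\times d$ matrix function that is continuous (and integrable over $\Omega$), symmetric and uniformly positive definite on $\Omega$; $f:\mathbb{R}\to\mathbb{R}$ is such that $f$ and $f'$ exist, are continuous, and are bounded for all bounded $u$; $u_0$ and $g$ are given functions (with $u_0$ defined at all mesh vertices). Mesh: $\mathcal{T}_h$ is a (conforming) simplicial triangulation of $\Omega$ with $N_e$ elements, $N_v$ vertices $\boldsymbol{x}_1,\ldots,\boldsymbol{x}_{N_v}$, of which the first $N_{vi}$ are the interior vertices (not on $\partial\Omega$). $\phi_j$ is the continuous piecewise linear basis function with $\phi_j(\boldsymbol{x}_i)=\delta_{ij}$. $|K|$ and $|\Omega|$ denote volumes; $\mathbb{D}_K$ is the average of $\mathbb{D}$ over $K\in\mathcal{T}_h$. Matrices: $M=(m_{ij})$ with $m_{ij}=\int_\Omega\phi_j\phi_i\,d\boldsymbol{x}$ for $i\le N_{vi}$ and $m_{ij}=0$ for $i>N_{vi}$; $A=(a_{ij})$ with $a_{ij}=\int_\Omega(\nabla\phi_i)^T\mathbb{D}\nabla\phi_j\,d\boldsymbol{x}=\sum_{K\in\mathcal{T}_h}|K|(\nabla\phi_i)^T\mathbb{D}_K\nabla\phi_j$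 (gradients taken on $K$) for $i\le N_{vi}$ and $a_{ij}=\delta_{ij}$ for $i>N_{vi}$ ($j=1,\ldots,N_v$). Time levels: $0=t_0<t_1<\cdots$ in $[0,T]$, $\Delta t_n=t_{n+1}-t_n$. The vector $\boldsymbol{u}^n=(u_1^n,\ldots,u_{N_v}^n)^T$ contains the nodal values of $u_h^n=\sum_{j=1}^{N_v}u_j^n\phi_j$, with initial vector $u_j^0=u_0(\boldsymbol{x}_j)$. $\boldsymbol{g}^{n+1}$ has entries $0$ for $i\le N_{vi}$ and $g(\boldsymbol{x}_i,t_{n+1})$ for $i>N_{vi}$. Mesh quantity: for each $K\in\mathcal{T}_h$ let $\phi_0,\ldots,\phi_d$ denote (local numbering) the linear basis functions on $K$ of its $d+1$ vertices, and set $$\mathbb{D}_{acute}=\left(\frac{|\Omega|}{N_e}\right)^{2/d}\min_{K\in\mathcal{T}_h}\ \min_{i,j=0,\ldots,d,\ i\ne j}\left(-(\nabla\phi_i)^T\mathbb{D}_K\nabla\phi_j\right).$$ Notation: $v^+=\max\{v,0\}$, $v^-=\min\{v,0\}$; $\max_{\boldsymbol{x}}$ is the maximum over $\overline{\Omega}$. *)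

(* Defs.v *)
From HB Require Import structures.
From mathcomp Require Import all_boot all_order all_algebra.
From mathcomp Require Import all_classical all_reals all_analysis.

Set Implicit Arguments.
Unset Strict Implicit.
Unset Printing Implicit Defensive.

Import Order.TTheory GRing.Theory Num.Theory.
Import numFieldNormedType.Exports.

Local Open Scope classical_set_scope.
Local Open Scope ring_scope.

(* Lebesgue measure on R^n.  Points of R^n are row vectors 'rV[R]_n.  The
   sigma-algebra is generated by the n coordinate maps, i.e. it is the Borel
   sigma-algebra; the measure is the n-fold product of the one-dimensional
   Lebesgue measure. *)

Definition rV_display : measure_display -> measure_display.
Proof. exact. Qed.

Section rV_measurable.
Context {R : realType} (n : nat).

Let coord (i : 'I_n) (x : 'rV[R]_n) : measurableTypeR R := x 0 i.

Let rV_set0 : g_sigma_preimage coord set0.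
Proof. exact: sigma_algebra0. Qed.

Let rV_setC A : g_sigma_preimage coord A -> g_sigma_preimage coord (~` A).
Proof. exact: sigma_algebraC. Qed.

Let rV_bigcup (F : (set 'rV[R]_n)^nat) :
  (forall i, g_sigma_preimage coord (F i)) ->
  g_sigma_preimage coord (\bigcup_i (F i)).
Proof. exact: sigma_algebra_bigcup. Qed.

HB.instance Definition _ := @isMeasurable.Build
  (rV_display default_measure_display) 'rV[R]_n (g_sigma_preimage coord) rV_set0 rV_setC rV_bigcup.

Lemma measurable_coord (i : 'I_n) :
  measurable_fun [set: 'rV[R]_n] (fun x => x 0 i : measurableTypeR R).
Proof.
move=> _ Y mY; rewrite setTI; apply: sub_sigma_algebra => /=.
rewrite -bigcup_seq/=; exists i => /=; first by rewrite mem_index_enum.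
by exists Y => //; rewrite setTI.
Qed.

Lemma measurable_fun_rVP d (T : measurableType d) (f : T -> 'rV[R]_n) :
  (forall i, measurable_fun [set: T] (fun t => f t 0 i : measurableTypeR R)) ->
  measurable_fun [set: T] f.
Proof.
move=> mf; apply: (@measurability _ _ _ _ _ _ (\big[setU/set0]_(i < n)
  preimage_set_system setT (coord i) measurable)) => //.
move=> X [A]; rewrite -bigcup_seq => -[i _ [B mB <-]] <- {X}.
by rewrite !setTI; have := mf i measurableT B mB; rewrite setTI.
Qed.

End rV_measurable.

Section lebesgue_rV.
Context {R : realType}.

Definition rV_cons n (p : measurableTypeR R * 'rV[R]_n) : 'rV[R]_n.+1 :=
  \row_i (if unlift ord0 i is Some j then p.2 0 j else p.1).

Definition rV_uncons n (x : 'rV[R]_n.+1) : measurableTypeR R * 'rV[R]_n :=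
  (x 0 ord0, \row_j x 0 (lift ord0 j)).

Lemma rV_consK n : cancel (@rV_cons n) (@rV_uncons n).
Proof.
move=> [a x]; rewrite /rV_uncons /rV_cons /= !mxE unlift_none; congr pair.
by apply/rowP => j; rewrite !mxE liftK.
Qed.

Lemma rV_unconsK n : cancel (@rV_uncons n) (@rV_cons n).
Proof.
move=> x; apply/rowP => i; rewrite !mxE.
by case: unliftP => [j ->|->] //=; rewrite mxE.
Qed.

Lemma measurable_rV_cons n : measurable_fun setT (@rV_cons n).
Proof.
apply: measurable_fun_rVP => i.
under eq_fun do rewrite mxE.
case: unliftP => [j _|_]; last exact: measurable_fst.
by apply: measurableT_comp (measurable_coord j) _; exact: measurable_snd.
Qed.

Lemma measurable_rV_uncons n : measurable_fun setT (@rV_uncons n).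
Proof.
apply: measurable_fun_pair; first exact: measurable_coord.
apply: measurable_fun_rVP => i; under eq_fun do rewrite mxE.
exact: measurable_coord.
Qed.

Section succ.
Variables (n : nat) (mu : {sigma_finite_measure set 'rV[R]_n -> \bar R}).

Definition lebesgue_rV_succ : set 'rV[R]_n.+1 -> \bar R :=
  pushforward (@lebesgue_measure R \x mu)%E (@rV_cons n).

Let nu : {measure set 'rV[R]_n.+1 -> \bar R} :=
  measure_function_pushforward__canonical__measure_function_Measure
    (@lebesgue_measure R \x mu)%E (@measurable_rV_cons n).

HB.instance Definition _ := Measure.copy lebesgue_rV_succ nu.

Lemma lebesgue_rV_succ_sigma_finite : sigma_finite setT lebesgue_rV_succ.
Proof.
have /sigma_finiteP[F [TF ndF Foo]] := sigma_finiteT (@lebesgue_measure R).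
have /sigma_finiteP[G [TG ndG Goo]] := sigma_finiteT mu.
exists (fun k => @rV_uncons n @^-1` (F k `*` G k)).
  apply/esym; rewrite -subTset => x _.
  have [/= k _ Fk] : (\bigcup_k F k) (rV_uncons x).1 by rewrite -TF.
  have [/= l _ Gl] : (\bigcup_k G k) (rV_uncons x).2 by rewrite -TG.
  exists (maxn k l) => //; split.
    by move: Fk; exact/subsetPset/ndF/leq_maxl.
  by move: Gl; exact/subsetPset/ndG/leq_maxr.
move=> k; have [mF Fk] := Foo k; have [mG Gk] := Goo k; split.
  rewrite -[X in measurable X]setTI; apply: measurable_rV_uncons => //.
  exact: measurableX.
rewrite /lebesgue_rV_succ /pushforward -comp_preimage.
rewrite (_ : _ \o _ = id); last by apply/funext; exact: rV_consK.
by rewrite preimage_id product_measure1E// lte_mul_pinfty// ge0_fin_numE.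
Qed.

HB.instance Definition _ := Measure_isSigmaFinite.Build _ _ _ lebesgue_rV_succ
  lebesgue_rV_succ_sigma_finite.

End succ.

Fixpoint lebesgue_rV n : {sigma_finite_measure set 'rV[R]_n -> \bar R} :=
  match n with
  | 0 => \d_(0 : 'rV[R]_0)
  | n'.+1 => lebesgue_rV_succ (lebesgue_rV n')
  end.

End lebesgue_rV.

Section geometry.
Context {R : realType} (d : nat).

Definition dot (v w : 'rV[R]_d) : R := (v *m w^T) 0 0.

Definition affine_indep (I : finType) (p : I -> 'rV[R]_d) (K : {set I}) : Prop :=
  forall a : I -> R, \sum_(i in K) a i = 0 -> \sum_(i in K) a i *: p i = 0 ->
  forall i, i \in K -> a i = 0.

Definition conv_hull (I : finType) (p : I -> 'rV[R]_d) (K : {set I}) :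
    set 'rV[R]_d :=
  [set y | exists a : I -> R, [/\ forall i, 0 <= a i,
    \sum_(i in K) a i = 1 & y = \sum_(i in K) a i *: p i]].

Definition boundary (A : set 'rV[R]_d) : set 'rV[R]_d := closure A `\` A°.

(* The boundary is a finite union of (d-1)-simplices (points if d = 1,
   segments if d = 2, triangles if d = 3). *)
Definition polyhedral_domain (Omega : set 'rV[R]_d) : Prop :=
  [/\ open Omega, connected Omega, bounded_set Omega, Omega !=set0 &
    exists (m : nat) (F : 'I_m -> 'I_d -> 'rV[R]_d),
      (forall k, affine_indep (F k) [set: 'I_d]) /\
      boundary Omega = \bigcup_k conv_hull (F k) [set: 'I_d]].

(* An element is the set of the indices of its d+1 vertices.  Conformity: two
   elements meet exactly in the simplex (possibly empty) spanned by their
   common vertices. *)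
Definition triangulation (Omega : set 'rV[R]_d) (Nv : nat)
    (x : 'I_Nv -> 'rV[R]_d) (Th : {set {set 'I_Nv}}) : Prop :=
  [/\ injective x,
      forall K, K \in Th -> #|K| = d.+1 /\ affine_indep x K,
      closure Omega = \bigcup_(K in [set` Th]) conv_hull x K,
      forall K L, K \in Th -> L \in Th ->
        conv_hull x K `&` conv_hull x L = conv_hull x (K :&: L) &
      forall i, exists2 K, K \in Th & i \in K].

Definition affine_on (S : set 'rV[R]_d) (psi : 'rV[R]_d -> R) : Prop :=
  exists (c : R) (g : 'rV[R]_d), forall y, S y -> psi y = c + dot g y.

Definition linear_basis (Omega : set 'rV[R]_d) (Nv : nat)
    (x : 'I_Nv -> 'rV[R]_d) (Th : {set {set 'I_Nv}})
    (phi : 'I_Nv -> 'rV[R]_d -> R) : Prop :=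
  [/\ forall j, {within closure Omega, continuous (phi j)},
      forall j K, K \in Th -> affine_on (conv_hull x K) (phi j) &
      forall i j, phi j (x i) = (i == j)%:R].

Definition grad (psi : 'rV[R]_d -> R) (y : 'rV[R]_d) : 'rV[R]_d :=
  \row_k 'D_(delta_mx 0 k) psi y.

(* The gradient on K of a function that is affine on K: it is constant in the
   interior of K, and is read off at the barycenter. *)
Definition grad_on (Nv : nat) (x : 'I_Nv -> 'rV[R]_d) (K : {set 'I_Nv})
    (psi : 'rV[R]_d -> R) : 'rV[R]_d :=
  grad psi (#|K|%:R^-1 *: \sum_(i in K) x i).

Definition vol (A : set 'rV[R]_d) : R := fine (lebesgue_rV d A).

Definition integral_on (A : set 'rV[R]_d) (h : 'rV[R]_d -> R) : R :=
  \int[lebesgue_rV d]_(y in A) h y.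

Definition diffusion_tensor (Omega : set 'rV[R]_d)
    (D : 'rV[R]_d -> 'M[R]_d) : Prop :=
  [/\ {within Omega, continuous D},
      forall k l, (lebesgue_rV d).-integrable Omega (fun y => (D y k l)%:E),
      forall y, Omega y -> (D y)^T = D y &
      exists2 alpha : R, 0 < alpha &
        forall y v, Omega y -> alpha * dot v v <= dot (v *m D y) v].

End geometry.

Section scheme.
Context {R : realType} (d : nat).
Variables (Omega : set 'rV[R]_d) (Nv Nvi : nat) (x : 'I_Nv -> 'rV[R]_d)
  (Th : {set {set 'I_Nv}}) (phi : 'I_Nv -> 'rV[R]_d -> R)
  (D : 'rV[R]_d -> 'M[R]_d).

(* D is only given on Omega; an element K may touch the boundary of Omega. *)
Definition avg_tensor (K : {set 'I_Nv}) : 'M[R]_d :=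
  \matrix_(k, l) ((vol (conv_hull x K))^-1 *
    integral_on (conv_hull x K `&` Omega) (fun y => D y k l)).

(* (|Omega| / N_e)^(2/d) *)
Definition mesh_scale : R := (vol Omega / #|Th|%:R) `^ (2 / d%:R).

(* The set is finite and, when there is an element and d > 0, nonempty: its
   infimum is a minimum. *)
Definition D_acute : R :=
  mesh_scale * inf [set r : R | exists K i j, [/\ K \in Th, i \in K, j \in K,
    i != j & r = - dot (grad_on x K (phi i) *m avg_tensor K)
                       (grad_on x K (phi j))]].

Definition mass_mx : 'M[R]_Nv :=
  \matrix_(i, j) if (i < Nvi)%N
    then integral_on Omega (fun y => phi j y * phi i y) else 0.

(* The gradients exist in the interiors of the elements, i.e. outside a
   Lebesgue-null subset of Omega. *)
Definition stiffness_mx : 'M[R]_Nv :=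
  \matrix_(i, j) if (i < Nvi)%N
    then integral_on Omega
           (fun y => dot (grad (phi i) y *m D y) (grad (phi j) y))
    else (i == j)%:R.

Definition weighted_mass_mx (w : 'rV[R]_d -> R) : 'M[R]_Nv :=
  \matrix_(i, j) if (i < Nvi)%N
    then integral_on Omega (fun y => w y * phi j y * phi i y) else 0.

Definition fe_fun (u : 'cV[R]_Nv) (y : 'rV[R]_d) : R :=
  \sum_j u j 0 * phi j y.

Definition boundary_vec (g : 'rV[R]_d -> R -> R) (t : R) : 'cV[R]_Nv :=
  \col_i if (i < Nvi)%N then 0 else g (x i) t.

End scheme.

Section heim.
Context {R : realType} (d : nat).
Implicit Types (f : R -> R) (uh : 'rV[R]_d -> R).

Definition neg_part f uh (y : 'rV[R]_d) : R := Num.min (f (uh y)) 0.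
Definition pos_part f uh (y : 'rV[R]_d) : R := Num.max (f (uh y)) 0.

(* The maximum of |f^-(u_h)| over the closure of Omega; it is attained since
   u_h is continuous on that compact set. *)
Definition max_neg_part (Omega : set 'rV[R]_d) f uh : R :=
  sup [set `|neg_part f uh y| | y in closure Omega].

Definition reaction f : Prop :=
  [/\ forall v, derivable f v 1, continuous f, continuous (derive1 f) &
    forall c : R, exists C : R, forall v, `|v| <= c ->
      `|f v| <= C /\ `|derive1 f v| <= C].

End heim.

(* Main.v *)
(* At a vertex where u^{n+1} is minimal, the signs and the row sums of the
   system matrix L = M - dt B + dt A force u^{n+1} >= 0 as soon as the
   right-hand side is nonnegative: in an interior row the off-diagonal entries
   are <= 0 and the row sum is > 0 (the row sums of A vanish because the basis
   functions add up to 1).  Since all basis functions are affine on an element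
   K, an off-diagonal entry of L is at most a sum over the elements K that
   contain both vertices of
     |K| ((1 + dt max|f^-|) / ((d+1)(d+2)) + dt (grad phi_i)^T D_K grad phi_j),
   and the time step condition says that each term is <= 0.

   The value |K| / ((d+1)(d+2)) of the integral of phi_i phi_j over K is obtained
   without a change of variables: {phi_i >= s, phi_j >= t} is a copy of K scaled
   by 1 - s - t, so it has volume (1 - s - t)^d |K|, and phi_i phi_j is below the
   normalized sum of the indicators of such sets over a lattice of values of
   (s, t).  The same scaling shows that the facets of K are null sets. *)

Require Import Defs.
From HB Require Import structures.
From mathcomp Require Import all_boot all_order all_algebra.
From mathcomp Require Import all_classical all_reals all_analysis.
From mathcomp Require Import measurable_realfun.
From mathcomp Require Import ring lra.

Set Implicit Arguments.
Unset Strict Implicit.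
Unset Printing Implicit Defensive.

Import Order.TTheory GRing.Theory Num.Theory.
Import numFieldNormedType.Exports.

Local Open Scope classical_set_scope.
Local Open Scope ring_scope.

(** * Lebesgue measure on row vectors *)

Import HBNNSimple.

(** The integral is a supremum over simple functions below [f], whether or not [f] is measurable. A
    simple function cut off on [N] keeps its integral and lies below the restriction of [f]. *)
Lemma ge0_integral_setD_null d (T : measurableType d) (R : realType)
    (mu : {measure set T -> \bar R}) (N : set T) (f : T -> \bar R) :
  measurable N -> mu N = 0%E -> (forall x, 0 <= f x)%E ->
  (\int[mu]_x (f \_ (~` N)) x = \int[mu]_x f x)%E.
Proof.
move=> mN N0 f0.
have fN0 x : (0 <= (f \_ (~` N)) x)%E by rewrite patchE; case: ifP.
apply/eqP; rewrite eq_le; apply/andP; split.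
  rewrite !ge0_integralTE//; apply: ereal_sup_le => /= _ [h hf <-].
  exists h => // x; apply: (le_trans (hf x)); rewrite patchE.
  by case: ifP => // _; exact: f0.
rewrite [leLHS]ge0_integralTE//; apply: ge_ereal_sup => _ [h hf <-].
rewrite -integralT_nnsfun (@ge0_negligible_integral _ _ _ _ setT N)//; last 2 first.
- exact/measurable_EFinP.
- by move=> x _; rewrite lee_fin.
rewrite setTD integral_mkcond !ge0_integralTE//; last first.
  by move=> x; rewrite patchE; case: ifP => // _; rewrite lee_fin.
apply: ereal_sup_le => /= _ [k kh <-]; exists k => // x.
apply: (le_trans (kh x)); rewrite !patchE; case: ifP => // _; exact: hf.
Qed.

(* Meant for a possibly non-measurable [f]: the gradients of the basis functions
   are junk on the facets of the elements. *)
Lemma integral_setD_null d (T : measurableType d) (R : realType)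
    (mu : {measure set T -> \bar R}) (D N : set T) (f : T -> \bar R) :
  measurable N -> mu N = 0%E ->
  (\int[mu]_(x in D `\` N) f x = \int[mu]_(x in D) f x)%E.
Proof.
move=> mN N0; rewrite integralE [RHS]integralE.
have h (g : T -> \bar R) : (forall x, 0 <= g x)%E ->
    (\int[mu]_(x in D `\` N) g x = \int[mu]_(x in D) g x)%E.
  move=> g0; rewrite integral_mkcond [RHS]integral_mkcond.
  rewrite -[RHS](@ge0_integral_setD_null _ _ _ _ N)//.
    by apply: eq_integral => x _; rewrite -patch_setI setIC -setDE.
  by move=> x; rewrite patchE; case: ifP.
by rewrite !h.
Qed.

(** The measure that sends [A] to [c] times the measure of its preimage gives half-open intervals
    their length, so by uniqueness it is Lebesgue measure. *)
Lemma lebesgue_measure_dilation (R : realType) (c b : R) (A : set R) :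
  0 < c -> measurable A ->
  lebesgue_measure ((fun a : R => c * a + b) @^-1` A)
    = (c^-1%:E * lebesgue_measure A)%E.
Proof.
move=> c0 mA.
have c0' : 0 <= c by exact: ltW.
pose T := measurableTypeR R.
have mf : measurable_fun [set: T] (fun a : T => c * a + b : T).
  exact: measurable_funD.
pose nu := mscale (NngNum c0')
  (measure_function_pushforward__canonical__measure_function_Measure
    (@lebesgue_measure R) mf).
suff -> : lebesgue_measure A = nu A.
  by rewrite /nu /mscale/= muleA -EFinM mulVf ?gt_eqF// mul1e.
apply: lebesgue_measure_unique mA => _ [[u v] _ <-].
transitivity (c%:E *
  lebesgue_measure ((fun a : R => c * a + b)%R @^-1` [set` `]u, v]]))%E => //.
rewrite (_ : _ @^-1` _ = [set` `](u - b) / c, (v - b) / c]]); last first.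
  apply/seteqP; split => x /=; rewrite !in_itv/= ltr_pdivrMr// ler_pdivlMr//;
    by rewrite ltrBlDr lerBrDr (mulrC x).
rewrite !lebesgue_measure_itv/= !lte_fin ltr_pM2r ?invr_gt0// ltrD2r.
case: ifP => // _; rewrite ?mule0//.
by rewrite -!EFinD -EFinM; congr (_%:E); field; rewrite gt_eqF.
Qed.

Section lebesgue_rV_theory.
Context {R : realType}.

Lemma lebesgue_rVS n (X : set 'rV[R]_n.+1) : lebesgue_rV n.+1 X =
  (@lebesgue_measure R \x lebesgue_rV n)%E (@rV_cons R n @^-1` X).
Proof. by []. Qed.

Lemma measurable_affine_rV n (c : R) (b : 'rV[R]_n) :
  measurable_fun setT (fun y : 'rV[R]_n => c *: y + b).
Proof.
apply: measurable_fun_rVP => i; under eq_fun do rewrite !mxE.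
apply: measurable_funD => //; apply: measurable_funM => //.
exact: measurable_coord.
Qed.

(** Induction on the dimension: a dilation acts separately on the first coordinate and on the
    others, so [c ^+ n.+1] times the pulled-back measure agrees with the product measure on
    rectangles, which determine it. *)
Lemma lebesgue_rV_dilation n (c : R) (b : 'rV[R]_n) (X : set 'rV[R]_n) :
  0 < c -> measurable X ->
  lebesgue_rV n ((fun y => c *: y + b) @^-1` X)
    = ((c^-1 ^+ n)%:E * lebesgue_rV n X)%E.
Proof.
move=> c0; elim: n => [|n IH] in b X *.
  move=> _; rewrite expr0 mul1e; congr (lebesgue_rV 0 _).
  apply/seteqP; split => y;
    by rewrite /preimage/= (_ : c *: y + b = y)//; apply/rowP => -[].
move=> mX.
have c0' : 0 <= c by exact: ltW.
pose b' : 'rV[R]_n := \row_j b 0 (lift ord0 j).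
pose S (p : measurableTypeR R * 'rV[R]_n) : measurableTypeR R * 'rV[R]_n :=
  (c * p.1 + b 0 ord0, c *: p.2 + b').
have mS : measurable_fun setT S.
  apply: measurable_fun_pair => /=.
    by apply: measurable_funD => //; exact: measurable_funM.
  by apply: measurableT_comp (measurable_affine_rV c b') _; exact: measurable_snd.
rewrite !lebesgue_rVS.
have -> : @rV_cons R n @^-1` ((fun y => c *: y + b) @^-1` X)
    = S @^-1` (@rV_cons R n @^-1` X).
  apply/seteqP; split => -[r y]; rewrite /preimage/= (_ : c *: _ + b = rV_cons (S (r, y)))//;
    apply/rowP => i; rewrite !mxE; by case: unliftP => [j ->|->]//=; rewrite !mxE.
set Y := @rV_cons R n @^-1` X.
have mY : measurable Y.
  rewrite -[Y]setTI; exact: measurable_rV_cons.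
have cn0 : 0 <= c ^+ n.+1 by exact: exprn_ge0.
pose nu := mscale (NngNum cn0)
  (measure_function_pushforward__canonical__measure_function_Measure
    (@lebesgue_measure R \x lebesgue_rV n)%E mS).
suff -> : (@lebesgue_measure R \x lebesgue_rV n)%E Y = nu Y.
  by rewrite /nu /mscale/= muleA -EFinM exprVn mulVf ?mul1e// gt_eqF// exprn_gt0.
apply: product_measure_unique mY => A B mA mB.
transitivity ((c ^+ n.+1)%:E * (@lebesgue_measure R \x lebesgue_rV n)
    (((fun a : R => (c * a + b 0 ord0)%R) @^-1` A)
      `*` ((fun y => (c *: y + b')%R) @^-1` B)))%E.
  rewrite /nu /mscale/=; congr (_ * _)%E; reflexivity.
rewrite product_measure1E; last 2 first.
- rewrite -[X in measurable X]setTI.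
  by have : measurable_fun setT (fun a : measurableTypeR R => c * a + b 0 ord0 : measurableTypeR R);
    [apply: measurable_funD => //; exact: measurable_funM|exact].
- by rewrite -[X in measurable X]setTI; exact: (measurable_affine_rV c b').
transitivity ((c ^+ n.+1)%:E * ((c^-1%:E * lebesgue_measure A)
    * ((c^-1 ^+ n)%:E * lebesgue_rV n B)))%E.
  congr (_ * (_ * _))%E; first exact: (lebesgue_measure_dilation (b 0 ord0) c0 mA).
  exact: IH.
rewrite muleACA -EFinM !muleA -EFinM.
by rewrite -exprS exprVn mulfV ?mul1e// gt_eqF// exprn_gt0.
Qed.

Definition box n (a b : 'rV[R]_n) : set 'rV[R]_n :=
  [set y | forall i, a 0 i < y 0 i < b 0 i].

Lemma measurable_box n (a b : 'rV[R]_n) : measurable (box a b).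
Proof.
rewrite (_ : box a b = \bigcap_(i in [set` 'I_n])
   ((fun y : 'rV[R]_n => y 0 i : measurableTypeR R) @^-1` `]a 0 i, b 0 i[)).
  apply: fin_bigcap_measurable => // i _; rewrite -[X in measurable X]setTI.
  exact: measurable_coord.
by apply/seteqP; split => y /= h i; [move=> _|]; have := h i; rewrite /= in_itv/=; apply.
Qed.

Lemma lebesgue_rV_box n (a b : 'rV[R]_n) : (forall i, a 0 i <= b 0 i) ->
  lebesgue_rV n (box a b) = (\prod_i (b 0 i - a 0 i))%:E.
Proof.
elim: n => [|n IH] in a b *.
  move=> _ /=; rewrite big_ord0 diracE mem_set//; by case.
move=> ab.
rewrite lebesgue_rVS.
have -> : @rV_cons R n @^-1` box a b =
   [set` `]a 0 ord0, b 0 ord0[] `*` box (\row_j a 0 (lift ord0 j)) (\row_j b 0 (lift ord0 j)).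
  apply/seteqP; split => -[r y]/=.
    move=> h; split; first by have := h ord0; rewrite in_itv/= mxE unlift_none.
    by move=> i; have := h (lift ord0 i); rewrite !mxE liftK.
  rewrite in_itv/= => -[h1 h2] i; rewrite mxE.
  by case: unliftP => [j ->|->//]; have := h2 j; rewrite !mxE.
transitivity (lebesgue_measure [set` `]a 0%R ord0, b 0%R ord0[] *
    lebesgue_rV n (box (\row_j a 0%R (lift ord0 j)) (\row_j b 0%R (lift ord0 j))))%E.
  by apply: product_measure1E => //; exact: measurable_box.
rewrite IH; last by move=> i; rewrite !mxE.
rewrite lebesgue_measure_itv/= lte_fin big_ord_recl EFinM.
congr (_ * _)%E; last by congr (_%:E); apply: eq_bigr => i _; rewrite !mxE.
by have := ab ord0; rewrite le_eqVlt => /orP[/eqP ->|->]; rewrite ?ltxx ?subrr ?EFinB.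
Qed.

(** Row vectors carry the sup norm, so volumes of balls reduce to products of side lengths. *)
Lemma ball_boxE n (y : 'rV[R]_n) (r : R) : 0 < r ->
  ball y r = box (y - const_mx r) (y + const_mx r).
Proof.
move=> r0; apply/seteqP; split => z /=.
  move=> -[_ h] i; have := h 0 i; rewrite /ball/= !mxE ltr_norml; lra.
move=> h; split => // i j; have := h j; rewrite ord1 /ball/= !mxE ltr_norml; lra.
Qed.

Lemma lebesgue_rV_ball_gt0 n (y : 'rV[R]_n) (r : R) : 0 < r ->
  (0 < lebesgue_rV n (ball y r))%E.
Proof.
move=> r0; rewrite ball_boxE// lebesgue_rV_box; last first.
  by move=> i; rewrite !mxE; lra.
by rewrite lte_fin; apply: prodr_gt0 => i _; rewrite !mxE; lra.
Qed.

Lemma lebesgue_rV_bounded n (X : set 'rV[R]_n) :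
  bounded_set X -> measurable X -> (lebesgue_rV n X < +oo)%E.
Proof.
move=> [M [_ bM]] mX.
pose r := `|M| + 2.
have r0 : 0 < r by rewrite /r ltr_wpDl.
apply: (@le_lt_trans _ _ (lebesgue_rV n (ball 0 r))).
  apply: le_measure; rewrite ?inE//; first by rewrite ball_boxE//; exact: measurable_box.
  move=> z Xz; have : `|z| <= `|M| + 1.
    by apply: bM => //; rewrite (le_lt_trans (ler_norm _))// ltrDl.
  rewrite -ball_normE/= sub0r normrN /r => /le_lt_trans; apply; lra.
rewrite ball_boxE// lebesgue_rV_box ?ltry// => i; rewrite !mxE; lra.
Qed.

(** The sigma-algebra is generated by the coordinates; open sets are reached through the countably
    many boxes with rational corners. *)
Lemma open_measurable_rV n (U : set 'rV[R]_n) : open U -> measurable U.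
Proof.
move=> oU.
pose q (p : 'rV[rat]_n * 'rV[rat]_n) : set 'rV[R]_n :=
  box (map_mx ratr p.1) (map_mx ratr p.2).
rewrite (_ : U = \bigcup_p (if `[< q p `<=` U >] then q p else set0)).
  apply: countable_bigcupT_measurable; first exact: countableP.
  by move=> p; case: ifP => // _; exact: measurable_box.
apply/seteqP; split => [y Uy|y [p _]]; last first.
  by case: ifPn => // /asboolP; exact.
have [r /= r0 rU] : exists2 r : R, 0 < r & ball y r `<=` U.
  by have /nbhs_ballP[r r0 rU] := open_nbhs_nbhs (conj oU Uy); exists r.
have hq (i : 'I_n) : exists ab : rat * rat,
    [/\ y 0 i - r < ratr ab.1 < y 0 i & y 0 i < ratr ab.2 < y 0 i + r].
  have /rat_in_itvoo[u] : y 0 i - r < y 0 i by lra.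
  have /rat_in_itvoo[v] : y 0 i < y 0 i + r by lra.
  by rewrite !in_itv/= => hv hu; exists (u, v).
have [ab hab] := choice hq.
exists (\row_i (ab i).1, \row_i (ab i).2) => //.
rewrite ifT; first by move=> i; rewrite !mxE; have [] := hab i; lra.
apply/asboolP => z hz; apply: rU; rewrite ball_boxE// => i.
by have := hz i; rewrite !mxE; have [] := hab i; lra.
Qed.

End lebesgue_rV_theory.

(** * Barycentric coordinates *)

Section dot_theory.
Context {R : realType} (d : nat).
Implicit Types (u v w : 'rV[R]_d).

Lemma dotE v w : dot v w = \sum_k v 0 k * w 0 k.
Proof. by rewrite /dot mxE; apply: eq_bigr => k _; rewrite mxE. Qed.

Lemma dotDr v w1 w2 : dot v (w1 + w2) = dot v w1 + dot v w2.
Proof. by rewrite /dot linearD mulmxDr mxE. Qed.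

Lemma dotZr v a w : dot v (a *: w) = a * dot v w.
Proof. by rewrite /dot linearZ -scalemxAr mxE. Qed.

Lemma dotDl v1 v2 w : dot (v1 + v2) w = dot v1 w + dot v2 w.
Proof. by rewrite /dot mulmxDl mxE. Qed.

Lemma dot0l w : dot 0 w = 0.
Proof. by rewrite /dot mul0mx mxE. Qed.

Lemma dot0r v : dot v 0 = 0.
Proof. by rewrite /dot trmx0 mulmx0 mxE. Qed.

Lemma dot_sumr (I : Type) (r : seq I) (P : pred I) v (F : I -> 'rV[R]_d) :
  dot v (\sum_(i <- r | P i) F i) = \sum_(i <- r | P i) dot v (F i).
Proof. by rewrite (big_morph (dot v) (dotDr v) (dot0r v)). Qed.

Lemma dot_suml (I : Type) (r : seq I) (P : pred I) w (F : I -> 'rV[R]_d) :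
  dot (\sum_(i <- r | P i) F i) w = \sum_(i <- r | P i) dot (F i) w.
Proof. by rewrite (big_morph (fun v : 'rV[R]_d => dot v w) (fun a b => dotDl a b w) (dot0l w)). Qed.

Lemma dot_deltar v k : dot v (delta_mx 0 k) = v 0 k.
Proof.
rewrite dotE (bigD1 k)//= mxE !eqxx mulr1 big1 ?addr0// => l /negbTE lk.
by rewrite mxE lk andbF mulr0.
Qed.

Lemma dot_inj v w : (forall y, dot v y = dot w y) -> v = w.
Proof. by move=> h; apply/rowP => k; rewrite -(dot_deltar v) -(dot_deltar w) h. Qed.

Lemma continuous_affine (c : R) v : continuous (fun y => c + dot v y : R).
Proof.
rewrite (_ : (fun y => _) = (fun y : 'rV[R]_d => c + \sum_k v 0 k * y 0 k)); last first.
  by apply/funext => y; rewrite dotE.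
have h k : continuous (fun y : 'rV[R]_d => v 0 k * y 0 k : R).
  move=> y; apply: (@continuousM _ _ (cst (v 0 k)) (fun y : 'rV[R]_d => y 0 k)).
    exact: cst_continuous.
  exact: coord_continuous.
move=> y; apply: (@continuousD _ _ _ (cst c) (fun y : 'rV[R]_d => \sum_k v 0 k * y 0 k)).
  exact: cst_continuous.
by apply: continuous_big => //; exact: add_continuous.
Qed.

Lemma measurable_affine (c : R) v :
  measurable_fun setT (fun y => c + dot v y : measurableTypeR R).
Proof.
under eq_fun do rewrite dotE.
apply: measurable_funD => //; apply: measurable_sum => k /=.
by apply: measurable_funM => //; exact: measurable_coord.
Qed.

Lemma derive_affine (c : R) v w y : 'D_w (fun y => c + dot v y : R) y = dot v w.
Proof.
rewrite /derive; apply: cvg_lim => //.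
apply: (@cvg_trans _ ((fun=> dot v w) @ 0^')); last exact: cvg_cst.
apply: near_eq_cvg; near=> h.
have h0 : h != 0 by near: h; exact: nbhs_dnbhs_neq.
rewrite /= dotDr dotZr [_ *: _](_ : _ = h^-1 * (h * dot v w)); last first.
  by congr (_ * _); lra.
by rewrite mulKf.
Unshelve. all: by end_near. Qed.

End dot_theory.

Section barycentric.
Context {R : realType} (d : nat).

(** The rows [(1, x i)] with [i] in [K] form a square matrix of size [d.+1]. Affine independence
    makes it row-free, hence row-full, and solving for [(1, y)] yields coefficients of any sign. *)
Lemma affine_indep_span (I : finType) (x : I -> 'rV[R]_d) (K : {set I}) :
  affine_indep x K -> #|K| = d.+1 -> forall y, exists a : I -> R,
  \sum_(i in K) a i = 1 /\ y = \sum_(i in K) a i *: x i.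
Proof.
move=> ind cK y.
pose P : 'M[R]_(#|K|, 1 + d) := \matrix_(i, j) row_mx (1%:M : 'M[R]_1) (x (enum_val i)) 0 j.
have PE (v : 'rV[R]_#|K|) : v *m P =
    row_mx ((\sum_i v 0 i)%:M) (\sum_i v 0 i *: x (enum_val i)).
  apply/rowP => j; rewrite mxE; under eq_bigr do rewrite mxE.
  case: (split_ordP j) => k ->.
    rewrite row_mxEl ord1 mxE mulr1n; apply: eq_bigr => i _.
    by rewrite row_mxEl mxE mulr1.
  by rewrite row_mxEr summxE; apply: eq_bigr => i _; rewrite row_mxEr mxE.
pose ext (v : 'rV[R]_#|K|) i := \sum_(k < #|K| | enum_val k == i) v 0 k.
have extE v k : ext v (enum_val k) = v 0 k.
  by rewrite /ext (big_pred1 k)// => l /=; rewrite (inj_eq enum_val_inj).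
have sumE v : \sum_(i in K) ext v i = \sum_i v 0 i.
  by rewrite big_enum_val; apply: eq_bigr => i _; rewrite extE.
have combE v : \sum_(i in K) ext v i *: x i = \sum_i v 0 i *: x (enum_val i).
  by rewrite big_enum_val; apply: eq_bigr => i _; rewrite extE.
have fP : row_full P.
  have : row_free P.
    apply: inj_row_free => v; rewrite PE => /eqP.
    rewrite -row_mx0 => /eqP/eq_row_mx[/matrixP/(_ 0 0)]; rewrite !mxE mulr1n => v1 v2.
    apply/rowP => k; rewrite mxE -extE; apply: ind; last exact: enum_valP.
      by rewrite sumE.
    by rewrite combE.
  by rewrite /row_free /row_full => /eqP ->; rewrite cK.
have /submxP[v] : (row_mx (1%:M : 'M[R]_1) y <= P)%MS by exact: submx_full.
rewrite PE => /eq_row_mx[/matrixP/(_ 0 0)]; rewrite !mxE !mulr1n => v1 v2.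
by exists (ext v); rewrite sumE combE.
Qed.

Lemma conv_hull_vertex (I : finType) (x : I -> 'rV[R]_d) (K : {set I}) i :
  i \in K -> conv_hull x K (x i).
Proof.
move=> iK; exists (fun j => (j == i)%:R); split.
- by move=> j; rewrite ler0n.
- rewrite (bigD1 i)//= eqxx big1 ?addr0// => j /andP[_ /negbTE ->//].
- rewrite (bigD1 i)//= eqxx scale1r big1 ?addr0// => j /andP[_ /negbTE ->].
  by rewrite scale0r.
Qed.

Lemma conv_hull_bounded (I : finType) (x : I -> 'rV[R]_d) (K : {set I}) :
  bounded_set (conv_hull x K).
Proof.
exists (\sum_(i in K) `|x i|); split; first exact: num_real.
move=> M /ltW hM y [a [a0 a1 ->]]; apply: le_trans hM.
apply: (le_trans (ler_norm_sum _ _ _)); apply: ler_sum => i iK.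
rewrite normrZ ger0_norm// ler_piMl// -a1 (bigD1 i)//= lerDl.
by apply: sumr_ge0.
Qed.

Context (Nv : nat) (x : 'I_Nv -> 'rV[R]_d) (K : {set 'I_Nv})
  (phi : 'I_Nv -> 'rV[R]_d -> R).
Hypothesis cardK : #|K| = d.+1.
Hypothesis indK : affine_indep x K.
Hypothesis affK : forall j, affine_on (conv_hull x K) (phi j).
Hypothesis phi_x : forall i j, phi j (x i) = (i == j)%:R.

(** On [K] each [phi j] agrees with an affine function on the whole space, and for these extensions
    the barycentric identities hold everywhere. Gradients and half-spaces are read off from them. *)
Lemma barycentric_extension : exists (c : 'I_Nv -> R) (g : 'I_Nv -> 'rV[R]_d),
  [/\ forall j y, conv_hull x K y -> phi j y = c j + dot (g j) y,
      forall y, \sum_(i in K) (c i + dot (g i) y) = 1,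
      forall y, y = \sum_(i in K) (c i + dot (g i) y) *: x i &
      forall j y, j \notin K -> c j + dot (g j) y = 0].
Proof.
have [c hc] := choice affK; have [g hg] := choice hc.
(* An affine function commutes with affine combinations, so the vertex values [phi_x] fix it. *)
have ell a j : \sum_(i in K) a i = 1 ->
    c j + dot (g j) (\sum_(i in K) a i *: x i) = if j \in K then a j else 0.
  move=> a1; rewrite dot_sumr -[c j]mul1r -a1 mulr_suml -big_split/=.
  rewrite (eq_bigr (fun i => if i == j then a i else 0)).
    rewrite -big_mkcondr/=; case: ifPn => jK.
      by rewrite (big_pred1 j)// => i /=; case: eqVneq => [->|]; rewrite ?jK ?andbF.
    rewrite big_pred0// => i; case: eqVneq => [->|]; rewrite ?andbF//.
    by rewrite (negbTE jK).
  move=> i iK; rewrite dotZr -mulrDr -hg; last exact: conv_hull_vertex.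
  by rewrite phi_x; case: eqP; rewrite ?mulr1 ?mulr0.
exists c, g; split=> [j y Ky|y|y|j y jK]; first exact: hg.
- have [a [a1 ->]] := affine_indep_span indK cardK y.
  by rewrite -[RHS]a1; apply: eq_bigr => i iK; rewrite ell// iK.
- have [a [a1 ->]] := affine_indep_span indK cardK y.
  by apply: eq_bigr => i iK; rewrite ell// iK.
- have [a [a1 ->]] := affine_indep_span indK cardK y.
  by rewrite ell// (negbTE jK).
Qed.

Lemma phi_notin j y : conv_hull x K y -> j \notin K -> phi j y = 0.
Proof.
have [c [g [hK _ _ h0]]] := barycentric_extension.
by move=> Ky jK; rewrite hK// h0.
Qed.

Lemma phi_sum1 y : conv_hull x K y -> \sum_(i in K) phi i y = 1.
Proof.
have [c [g [hK h1 _ _]]] := barycentric_extension.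
by move=> Ky; rewrite -(h1 y); apply: eq_bigr => i _; rewrite hK.
Qed.

Lemma phi_comb y : conv_hull x K y -> y = \sum_(i in K) phi i y *: x i.
Proof.
have [c [g [hK _ h1 _]]] := barycentric_extension.
by move=> Ky; rewrite {1}(h1 y); apply: eq_bigr => i _; rewrite hK.
Qed.

(** Uniqueness of barycentric coordinates: the numbers [phi i y - a i] have sum zero and give a
    vanishing combination of the vertices, so affine independence makes them zero. *)
Lemma phi_barycentric (a : 'I_Nv -> R) j :
  (forall i, 0 <= a i) -> \sum_(i in K) a i = 1 -> j \in K ->
  phi j (\sum_(i in K) a i *: x i) = a j.
Proof.
move=> a0 a1 jK; set y := \sum_(_ in K) _.
have Ky : conv_hull x K y by exists a.
have /indK/(_ j jK)/eqP : \sum_(i in K) (phi i y - a i) *: x i = 0.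
  under eq_bigr do rewrite scalerBl.
  by rewrite sumrB -phi_comb// subrr.
rewrite subr_eq0 => /(_ _)/eqP; apply.
by rewrite sumrB phi_sum1// a1 subrr.
Qed.

Lemma phi_ge0 j y : conv_hull x K y -> 0 <= phi j y.
Proof.
move=> Ky; have [jK|jK] := boolP (j \in K); last by rewrite phi_notin.
by move: Ky => [a [a0 a1 ->]]; rewrite phi_barycentric.
Qed.

Lemma phi_le1 j y : conv_hull x K y -> phi j y <= 1.
Proof.
move=> Ky; have [jK|jK] := boolP (j \in K); last by rewrite phi_notin.
rewrite -(phi_sum1 Ky) (bigD1 j)//= lerDl; apply: sumr_ge0 => i _.
exact: phi_ge0.
Qed.

Lemma phi_sumT y : conv_hull x K y -> \sum_i phi i y = 1.
Proof.
move=> Ky; rewrite -(phi_sum1 Ky) [RHS]big_mkcond/=; apply: eq_bigr => i _.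
by case: ifPn => // iK; rewrite phi_notin.
Qed.

(** The interior of the simplex, described by strictly positive barycentric coordinates; on it the
    gradients of the basis functions are genuine and constant. *)
Definition open_simplex : set 'rV[R]_d :=
  [set y | conv_hull x K y /\ forall i, i \in K -> 0 < phi i y].

Lemma open_simplexE c (g : 'I_Nv -> 'rV[R]_d) :
  (forall j y, conv_hull x K y -> phi j y = c j + dot (g j) y) ->
  (forall y, \sum_(i in K) (c i + dot (g i) y) = 1) ->
  (forall y, y = \sum_(i in K) (c i + dot (g i) y) *: x i) ->
  (forall j y, j \notin K -> c j + dot (g j) y = 0) ->
  open_simplex = \bigcap_(i in [set` K]) [set y | 0 < c i + dot (g i) y] /\
  conv_hull x K = \bigcap_(i in [set` K]) [set y | 0 <= c i + dot (g i) y].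
Proof.
move=> hK h1 hx h0.
have KE : conv_hull x K = \bigcap_(i in [set` K]) [set y | 0 <= c i + dot (g i) y].
  apply/seteqP; split => y; first by move=> Ky i iK /=; rewrite -hK// phi_ge0.
  move=> h; exists (fun i => c i + dot (g i) y); split => //.
  by move=> i; have [/h//|iK] := boolP (i \in K); rewrite h0.
split => //; apply/seteqP; split => y.
  by move=> [Ky h] i iK /=; rewrite -hK// h.
move=> h; have Ky : conv_hull x K y by rewrite KE => i /h /ltW.
by split => // i iK; rewrite hK//; exact: h.
Qed.

Lemma open_simplex_open : open open_simplex.
Proof.
have [c [g [hK h1 hx h0]]] := barycentric_extension.
have [-> _] := open_simplexE hK h1 hx h0.
rewrite openE => y hy.
have : \forall z \near y, forall i, i \in K -> 0 < c i + dot (g i) z.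
  apply: (@filter_forall _ _ (fun i z => i \in K -> 0 < c i + dot (g i) z) (nbhs y)) => i.

  have [iK|iK] := boolP (i \in K); last exact: nearW.
  have : nbhs y [set z | 0 < c i + dot (g i) z].
    apply: open_nbhs_nbhs; split; last exact: hy.
    apply: (@open_comp _ _ _ [set r : R | 0 < r]); last exact: open_gt.
    by move=> z _; exact: continuous_affine.
  by apply: filterS => z.
by apply: filterS => z hz i /=; exact: hz.
Qed.

Lemma barycenter_open_simplex :
  open_simplex (#|K|%:R^-1 *: \sum_(i in K) x i).
Proof.
pose a (_ : 'I_Nv) : R := #|K|%:R^-1.
have a0 i : 0 <= a i by rewrite invr_ge0 ler0n.
have a1 : \sum_(i in K) a i = 1.
  by rewrite sumr_const -[LHS]mulr_natr mulVf// pnatr_eq0 cardK.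
have -> : #|K|%:R^-1 *: \sum_(i in K) x i = \sum_(i in K) a i *: x i.
  by rewrite scaler_sumr.
split; first by exists a.
by move=> i iK; rewrite phi_barycentric// invr_gt0 ltr0n cardK.
Qed.

Lemma grad_open_simplex c (g : 'I_Nv -> 'rV[R]_d) j y :
  (forall j y, conv_hull x K y -> phi j y = c j + dot (g j) y) ->
  open_simplex y -> grad (phi j) y = g j.
Proof.
move=> hK Ky; apply/rowP => k; rewrite mxE.
rewrite -(dot_deltar (g j) k) -(derive_affine (c j) _ _ y).
apply: near_eq_derive.
have : nbhs y open_simplex.
  by apply: open_nbhs_nbhs; split=> //; exact: open_simplex_open.
by apply: filterS => z [Kz _]; exact: hK.
Qed.

Lemma grad_onE c (g : 'I_Nv -> 'rV[R]_d) j :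
  (forall j y, conv_hull x K y -> phi j y = c j + dot (g j) y) ->
  grad_on x K (phi j) = g j.
Proof. by move=> hK; exact: (grad_open_simplex _ hK barycenter_open_simplex). Qed.

Lemma grad_constant j y : open_simplex y ->
  grad (phi j) y = grad_on x K (phi j).
Proof.
have [c [g [hK _ _ _]]] := barycentric_extension.
by move=> Ky; rewrite (grad_onE j hK) (grad_open_simplex j hK).
Qed.

Lemma grad_on_notin j : j \notin K -> grad_on x K (phi j) = 0.
Proof.
have [c [g [hK _ _ h0]]] := barycentric_extension.
move=> jK; rewrite (grad_onE j hK); apply: dot_inj => y.
(* Comparing the values at [y] and at 0 removes the constant term and leaves the linear part. *)
have := h0 j 0 jK; have := h0 j y jK; rewrite dot0l dot0r; lra.
Qed.

Lemma grad_on_sum : \sum_j grad_on x K (phi j) = 0.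
Proof.
have [c [g [hK h1 _ h0]]] := barycentric_extension.
rewrite (bigID (mem K))/= [X in _ + X]big1 ?addr0; last first.
  by move=> i; exact: grad_on_notin.
under eq_bigr do rewrite (grad_onE _ hK).
apply: dot_inj => y; rewrite dot_suml dot0l.
(* The affine extensions sum to 1 everywhere, so subtracting the value at 0 shows that their linear
   parts cancel. *)
have := h1 y; have := h1 0; rewrite !big_split/= [X in _ + X = 1 -> _]big1; last first.
  by move=> i _; rewrite dot0r.
lra.
Qed.

End barycentric.

(** * Measure of a simplex *)

(** A discrete bound for the integral of t^d. Peeling off the first term leaves (m+1)^(d+1) +
    (d+1)(m+1)^d <= (m+2)^(d+1), the first two terms of a binomial expansion. Truncated differences
    contribute 0 because d > 0. *)
Lemma sum_subn_expn d m N : (0 < d)%N ->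
  (d.+1 * \sum_(l < N) (m - l) ^ d <= m.+1 ^ d.+1)%N.
Proof.
move=> d0; elim: N m => [|N IH] m; first by rewrite big_ord0 muln0.
rewrite big_ord_recl subn0; case: m => [|m].
  rewrite big1 => [|i _]; first by rewrite exp0n// muln0.
  by rewrite sub0n exp0n.
rewrite mulnDr; under eq_bigr do rewrite /= /bump leq0n add1n subSS.
apply: (leq_trans (leq_add (leqnn _) (IH m))).
rewrite -[m.+2]addn1 expnDn 2!big_ord_recl /= /bump/= add1n.
rewrite bin0 bin1 subn0 subn1/=.
by rewrite !exp1n !muln1 mul1n addnA [X in (_ <= X + _)%N]addnC leq_addr.
Qed.

(** Discrete form of the integral of (1-s-t)^d over the triangle s, t >= 0, s + t <= 1, which is
    1/((d+1)(d+2)). The one-variable bound is applied in each variable and costs a unit shift each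
    time. *)
Lemma sum_simplex_lattice d N : (0 < d)%N ->
  (d.+1 * d.+2 * \sum_(k < N) \sum_(l < N) (N - (k + l)) ^ d <= N.+2 ^ d.+2)%N.
Proof.
move=> d0; rewrite mulnAC mulnC big_distrr/=.
apply: leq_trans (sum_subn_expn N.+1 N (ltn0Sn d)); rewrite leq_mul2l/=.
apply: leq_sum => k _; rewrite subSn; last exact: ltnW.
under eq_bigr do rewrite subnDA.
exact: sum_subn_expn.
Qed.

(** Used with [b] equal to [N] times a basis function: a function with values in [0,1] is at most
    the average of the indicators of its [N] superlevel sets. *)
Lemma le_sum_indic (R : realType) N (b : R) :
  b <= N%:R -> b <= \sum_(k < N) (k%:R < b)%R%:R.
Proof.
elim: N => [|N IH] bN; first by rewrite big_ord0.
have [bN'|Nb] := leP b N%:R.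
  by rewrite big_ord_recr/= ler_wpDr// IH.
apply: (le_trans bN); rewrite (eq_bigr (fun=> 1)) ?sumr_const ?card_ord// => k _.
by rewrite (le_lt_trans _ Nb)// ler_nat -ltnS.
Qed.

Lemma le_of_riemann (R : realType) (m : nat) (I V : R) :
  (forall N : nat, (0 < N)%N -> I <= V * (N.+2%:R / N%:R) ^+ m) -> I <= V.
Proof.
move=> h.
have cst_cvg (c : R) : (fun _ : nat => c) @ \oo --> c by exact: cvg_cst.
have h1 : (fun N : nat => 1 + 2 * N.+1%:R^-1) @ \oo --> (1 : R).
  have := cvgD (cst_cvg 1) (cvgM (cst_cvg 2) (@cvg_harmonic R)).
  by rewrite mulr0 addr0; exact.
have hc : (fun N : nat => V * (1 + 2 * N.+1%:R^-1) ^+ m) @ \oo --> V.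
  have := cvgM (cst_cvg V) (cvg_comp _ _ h1 (@exprn_continuous R m 1)).
  by rewrite expr1n mulr1; exact.
apply: (ler_cvg_to (cst_cvg I) hc).
(* At [N.+1] the ratio is (N+3)/(N+1) = 1 + 2/(N+1), which tends to 1. *)
near=> N; have := h N.+1 isT; rewrite (_ : N.+3%:R / _ = 1 + 2 * N.+1%:R^-1)//.
by rewrite -[N.+3]addn2 natrD mulrDl divff ?pnatr_eq0.
Unshelve. all: by end_near. Qed.

Section simplex_measure.
Context {R : realType} (d : nat) (Nv : nat) (x : 'I_Nv -> 'rV[R]_d)
  (K : {set 'I_Nv}) (phi : 'I_Nv -> 'rV[R]_d -> R).
Hypothesis d_gt0 : (0 < d)%N.
Hypothesis cardK : #|K| = d.+1.
Hypothesis indK : affine_indep x K.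
Hypothesis affK : forall j, affine_on (conv_hull x K) (phi j).
Hypothesis phi_x : forall i j, phi j (x i) = (i == j)%:R.

Let H := conv_hull x K.

Lemma measurable_conv_hull : measurable H.
Proof.
have [c [g [hK h1 hx h0]]] := barycentric_extension cardK indK affK phi_x.
have [_ KE] := open_simplexE cardK indK affK phi_x hK h1 hx h0.
rewrite /H KE.
apply: fin_bigcap_measurable => [|i _]; first exact: finite_finset.
rewrite [X in measurable X](_ : _ = (fun y => c i + dot (g i) y : measurableTypeR R)
   @^-1` `[0, +oo[); last first.
  by apply/seteqP; split=> y /=; rewrite in_itv/= andbT.
by rewrite -[X in measurable X]setTI; exact: measurable_affine.
Qed.

Lemma measurable_phi j : measurable_fun H (phi j : _ -> measurableTypeR R).
Proof.
have [c [g [hK _ _ _]]] := barycentric_extension cardK indK affK phi_x.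
apply: (eq_measurable_fun (fun y => c j + dot (g j) y)).
  by move=> y; rewrite inE => Hy; rewrite hK.
by apply: measurable_funS (measurable_affine (c j) (g j)).
Qed.

Lemma conv_hull_fin : (lebesgue_rV d H < +oo)%E.
Proof.
apply: lebesgue_rV_bounded; last exact: measurable_conv_hull.
exact: conv_hull_bounded.
Qed.

Lemma conv_hull_volE : lebesgue_rV d H = (vol H)%:E.
Proof. by rewrite /vol fineK// ge0_fin_numE// conv_hull_fin. Qed.

Lemma vol_ge0 : 0 <= vol H. Proof. by rewrite /vol fine_ge0. Qed.

(* The homothety that maps the subsimplex {phi_i >= s_i for all i} of K onto K. *)
Let shrink (s : 'I_Nv -> R) (y : 'rV[R]_d) : 'rV[R]_d :=
  (1 - \sum_(i in K) s i)^-1 *: y +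
  - ((1 - \sum_(i in K) s i)^-1 *: \sum_(i in K) s i *: x i).

Let measurable_shrink s : measurable (shrink s @^-1` H).
Proof.
rewrite -[X in measurable X]setTI; apply: measurable_affine_rV => //.
exact: measurable_conv_hull.
Qed.

Let lebesgue_shrink s : \sum_(i in K) s i < 1 ->
  lebesgue_rV d (shrink s @^-1` H) =
  (((1 - \sum_(i in K) s i) ^+ d)%:E * lebesgue_rV d H)%E.
Proof.
move=> s1; rewrite lebesgue_rV_dilation ?invrK//; last exact: measurable_conv_hull.
by rewrite invr_gt0 subr_gt0.
Qed.

Let shrinkP s y : \sum_(i in K) s i < 1 -> (forall i, 0 <= s i) ->
  H y /\ (forall i, i \in K -> s i <= phi i y) <-> (shrink s @^-1` H) y.
Proof.
move=> s1 s0; set c := 1 - \sum_(i in K) s i.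
have c0 : 0 < c by rewrite subr_gt0.
split.
  move=> [Hy sy].
  pose a i := if i \in K then c^-1 * (phi i y - s i) else 0.
  exists a; split.
  - move=> i; rewrite /a; case: ifPn => // iK.
    by rewrite mulr_ge0 ?invr_ge0 ?(ltW c0)// subr_ge0 sy.
  - rewrite (eq_bigr (fun i => c^-1 * (phi i y - s i))); last by move=> i; rewrite /a => ->.
    rewrite -mulr_sumr sumrB (phi_sum1 cardK indK affK phi_x Hy) -/c.
    by rewrite mulVf// gt_eqF.
  - rewrite (eq_bigr (fun i => c^-1 *: (phi i y *: x i) - c^-1 *: (s i *: x i))).
      rewrite sumrB -!scaler_sumr -(phi_comb cardK indK affK phi_x Hy).
      by rewrite /shrink.
    by move=> i; rewrite /a => ->; rewrite -scalerA scalerBl scalerBr.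
move=> [a [a0 a1 ya]].
pose b i := s i + c * a i.
have b0 i : 0 <= b i by rewrite addr_ge0// mulr_ge0// ltW.
have b1 : \sum_(i in K) b i = 1 by rewrite big_split/= -mulr_sumr a1 mulr1 addrC subrK.
have yb : y = \sum_(i in K) b i *: x i.
  under eq_bigr do rewrite scalerDl -scalerA.
  rewrite big_split/= -scaler_sumr -ya /shrink -/c scalerDr scalerN !scalerA.
  by rewrite mulfV ?gt_eqF// !scale1r addrC subrK.
split; first by exists b.
move=> i iK; rewrite yb (phi_barycentric cardK indK affK phi_x b0 b1 iK).
by rewrite lerDl mulr_ge0// ltW.
Qed.

(** The part of [K] where [phi i] is at least s > 0 has volume (1-s)^d |K| and misses the facet, so
    the facet has measure at most (1 - (1-s)^d) |K|; then s tends to 0. *)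
Lemma lebesgue_face i : i \in K ->
  lebesgue_rV d (H `&` [set y | phi i y = 0]) = 0%E.
Proof.
move=> iK; set F := _ `&` _.
have mF : measurable F.
  rewrite /F (_ : [set y | _] = phi i @^-1` [set 0 : measurableTypeR R])//.
  by apply: measurable_phi => //; exact: measurable_conv_hull.
have FE : lebesgue_rV d F = (fine (lebesgue_rV d F))%:E.
  rewrite fineK// ge0_fin_numE//; apply: le_lt_trans conv_hull_fin.
  by apply: le_measure; rewrite ?inE//; [exact: measurable_conv_hull|move=> y []].
have key (s : R) : 0 < s < 1 ->
    fine (lebesgue_rV d F) <= vol H * (1 - (1 - s) ^+ d).
  move=> /andP[s0 s1].
  pose e j := if j == i then s else 0 : R.
  have eK : \sum_(j in K) e j = s.
    rewrite (bigD1 i)//= /e eqxx big1 ?addr0// => j /andP[_ /negbTE ->//].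
  have e1 : \sum_(j in K) e j < 1 by rewrite eK.
  have e0 j : 0 <= e j by rewrite /e; case: ifP => // _; exact: ltW.
  have FS : F `&` (shrink e @^-1` H) = set0.
    rewrite -subset0 => y [[_ /= y0] /(shrinkP y e1 e0)[_ /(_ i iK)]].
    by rewrite y0 /e eqxx leNgt s0.
  have : (lebesgue_rV d F + lebesgue_rV d (shrink e @^-1` H) <= lebesgue_rV d H)%E.
    rewrite -measureU//; apply: le_measure; rewrite ?inE.
    - by apply: measurableU.
    - exact: measurable_conv_hull.
    - by move=> y [[]//|/(shrinkP y e1 e0)[]].
  rewrite lebesgue_shrink// eK conv_hull_volE [X in (X + _)%E]FE.
  rewrite -EFinM -EFinD lee_fin; nra.
have F0 : fine (lebesgue_rV d F) <= 0.
  have cst_cvg (c : R) : (fun _ : nat => c) @ \oo --> c by exact: cvg_cst.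
  (* The choice s = 1/(n+2) stays strictly below 1, as [key] requires. *)
  have hc : (fun n : nat => vol H * (1 - (1 - n.+2%:R^-1) ^+ d)) @ \oo --> (0 : R).
    have h1 : (fun n : nat => 1 - n.+2%:R^-1) @ \oo --> (1 : R).
      have := cvgB (cst_cvg 1) (@cvg_harmonic R).
      by rewrite subr0 -cvg_shiftS; exact.
    have := cvgM (cst_cvg (vol H)) (cvgB (cst_cvg 1)
      (cvg_comp _ _ h1 (@exprn_continuous R d 1))).
    by rewrite expr1n subrr mulr0; exact.
  apply: (ler_cvg_to (cst_cvg _) hc).
  near=> n; apply: key; rewrite invr_gt0 ltr0n/= invf_lt1 ?ltr1n//.
rewrite FE; congr (_%:E); apply/eqP; rewrite eq_le F0 fine_ge0.
Unshelve. all: by end_near. Qed.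

Lemma integral_phi_phi i j : i \in K -> j \in K -> i != j ->
  (\int[lebesgue_rV d]_(y in H) (phi i y * phi j y)%:E
    <= (vol H / (d.+1%:R * d.+2%:R))%:E)%E.
Proof.
move=> iK jK ij.
have mH := measurable_conv_hull.
have mP : measurable_fun H (fun y => phi i y * phi j y : measurableTypeR R).
  by apply: measurable_funM; exact: measurable_phi.
have P0 y : H y -> 0 <= phi i y * phi j y.
  by move=> Hy; rewrite mulr_ge0// (phi_ge0 cardK indK affK phi_x).
(* One bound for each lattice of [N] levels suffices; the case [N = 1] also gives finiteness of the
   integral. *)
suff key N : (0 < N)%N ->
    (\int[lebesgue_rV d]_(y in H) (phi i y * phi j y)%:E
    <= (vol H / (d.+1%:R * d.+2%:R) * (N.+2%:R / N%:R) ^+ d.+2)%:E)%E.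
  have fin : (\int[lebesgue_rV d]_(y in H) (phi i y * phi j y)%:E)%E \is a fin_num.
    rewrite ge0_fin_numE; last by apply: integral_ge0 => y Hy; rewrite lee_fin P0.
    by apply: le_lt_trans (key 1%N isT) _; rewrite ltry.
  rewrite -(fineK fin) lee_fin; apply: (@le_of_riemann _ d.+2) => N N0.
  by rewrite -lee_fin (fineK fin); exact: key.
move=> N0.
(* Superlevel sets at the lattice point (k/N, l/N). The strict inequalities make the set empty as
   soon as k + l >= N. *)
pose S (k l : 'I_N) := H `&` [set y | k%:R < N%:R * phi i y /\ l%:R < N%:R * phi j y].
have mS k l : measurable (S k l).
  rewrite (_ : S k l = (H `&` (phi i : _ -> measurableTypeR R) @^-1` `]k%:R / N%:R, +oo[)
     `&` (H `&` (phi j : _ -> measurableTypeR R) @^-1` `]l%:R / N%:R, +oo[)).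
    by apply: measurableI; apply: measurable_phi.
  apply/seteqP; split => y; rewrite /S /= !in_itv/= !andbT !ltr_pdivrMr ?ltr0n//.
    by move=> [Hy []]; rewrite ![N%:R * _]mulrC.
  by move=> [[Hy +] [_]]; rewrite ![N%:R * _]mulrC.
(* For k + l < N the set lies in a copy of [K] scaled by 1 - (k+l)/N, with weight k/N at [i] and l/N
   at [j]. Otherwise it is empty, and the bound only has to be nonnegative. *)
have volS (k l : 'I_N) :
    (lebesgue_rV d (S k l) <= (vol H * ((N - (k + l))%N%:R / N%:R) ^+ d)%:E)%E.
  have [kl|kl] := ltnP (k + l) N.
    pose e m : R := if m == i then k%:R / N%:R else if m == j then l%:R / N%:R else 0.
    have eK : \sum_(m in K) e m = (k + l)%:R / N%:R.
      rewrite (bigD1 i)//= (bigD1 j)//=; last by rewrite jK eq_sym.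
      rewrite /e !eqxx eq_sym (negbTE ij) big1 ?addr0 ?natrD ?mulrDl//.
      by move=> m /andP[/andP[_ /negbTE ->] /negbTE ->].
    have e1 : \sum_(m in K) e m < 1.
      by rewrite eK ltr_pdivrMr ?ltr0n// mul1r ltr_nat.
    have e0 m : 0 <= e m by rewrite /e; do 2?case: ifP => // _; rewrite divr_ge0.
    have -> : (N - (k + l))%N%:R / N%:R = 1 - \sum_(m in K) e m :> R.
      by rewrite eK natrB ?(ltnW kl)// mulrBl divff// pnatr_eq0 -lt0n.
    rewrite mulrC EFinM -conv_hull_volE -lebesgue_shrink//.
    apply: le_measure; rewrite ?inE//.
    move=> y [Hy [ky ly]]; apply/(shrinkP y e1 e0); split=> // m mK; rewrite /e.
    case: eqP => [->|_]; first by rewrite ler_pdivrMr ?ltr0n// mulrC ltW.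
    case: eqP => [->|_]; first by rewrite ler_pdivrMr ?ltr0n// mulrC ltW.
    exact: (phi_ge0 cardK indK affK phi_x).
  rewrite (_ : S k l = set0).
    by rewrite measure0 lee_fin mulr_ge0 ?vol_ge0// exprn_ge0// divr_ge0.
  rewrite -subset0 => y [Hy [/= ky ly]].
  have : phi i y + phi j y <= 1.
    rewrite -(phi_sum1 cardK indK affK phi_x Hy) (bigD1 i)//= (bigD1 j)//=;
      last by rewrite jK eq_sym.
    rewrite addrA lerDl; apply: sumr_ge0 => m _; exact: (phi_ge0 cardK indK affK phi_x).
  move=> h; have : N%:R * (phi i y + phi j y) <= N%:R by rewrite ler_piMr.
  apply/negP; rewrite -ltNge mulrDr; apply: le_lt_trans (ltrD ky ly).
  by rewrite -natrD ler_nat.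
(* The product of the two averages of indicators that dominate [phi i] and [phi j]. *)
pose G y : R := \sum_(p : 'I_N * 'I_N) (N%:R^-1 ^+ 2) * \1_(S p.1 p.2) y.
have PG y : H y -> phi i y * phi j y <= G y.
  move=> Hy.
  have h m : phi m y <= N%:R^-1 * \sum_(k < N) (k%:R < N%:R * phi m y)%R%:R.
    rewrite ler_pdivlMl ?ltr0n//; apply: le_sum_indic.
    by rewrite ler_piMr// (phi_le1 cardK indK affK phi_x).
  apply: (le_trans (ler_pM _ _ (h i) (h j))); rewrite ?(phi_ge0 cardK indK affK phi_x)//.
  rewrite mulrACA -expr2 big_distrlr/= pair_big/= mulr_sumr /G.
  rewrite le_eqVlt; apply/orP; left; apply/eqP; apply: eq_bigr => -[k l] _ /=.
  congr (_ * _); rewrite indicE -natrM mulnb; congr ((_ : bool)%:R).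
  apply/idP/idP => [/andP[? ?]|]; first by rewrite inE.
  by rewrite inE => -[_ [-> ->]].
apply: (@le_trans _ _ (\int[lebesgue_rV d]_(y in H)
   (\sum_(p : 'I_N * 'I_N) (N%:R^-1 ^+ 2 * \1_(S p.1 p.2) y)%:E))%E).
  apply: ge0_le_integral => //.
  - exact/measurable_EFinP.
  - apply: emeasurable_sum => p; apply/measurable_EFinP.
    by apply: measurable_funM => //; exact: measurable_indic.
  - by move=> y Hy; rewrite sumEFin lee_fin; exact: PG.
have mI p : measurable_fun H
    (fun y => (N%:R^-1 ^+ 2 * \1_(S p.1 p.2) y : R)%:E).
  apply/measurable_EFinP; apply: measurable_funM => //; exact: measurable_indic.
have I0 p y : H y -> (0 <= (N%:R^-1 ^+ 2 * \1_(S p.1 p.2) y : R)%:E)%E.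
  by move=> _; rewrite lee_fin mulr_ge0// exprn_ge0.
rewrite (ge0_integral_sum _ mH mI I0).
apply: (@le_trans _ _ (\sum_(p : 'I_N * 'I_N)
   (N%:R^-1 ^+ 2 * (vol H * ((N - (p.1 + p.2))%N%:R / N%:R) ^+ d))%:E)%E).
  apply: lee_sum => p _; under eq_integral do rewrite EFinM.
  rewrite ge0_integralZl_EFin//; last by apply/measurable_EFinP; exact: measurable_indic.
  rewrite integral_indic// [X in (_ <= X)%E]EFinM lee_pmul2l//;
    last by rewrite lte_fin exprn_gt0// invr_gt0 ltr0n.
  apply: le_trans (volS p.1 p.2); apply: le_measure; rewrite ?inE//.
  exact: measurableI.
rewrite sumEFin lee_fin -mulr_sumr -mulr_sumr.
rewrite (eq_bigr (fun p : 'I_N * 'I_N => ((N - (p.1 + p.2)) ^ d)%N%:R * N%:R^-1 ^+ d)); last first.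
  by move=> p _; rewrite exprMn natrX.
rewrite -mulr_suml -natr_sum -(pair_big predT predT (fun k l : 'I_N => ((N - (k + l)) ^ d)%N))/=.
(* What remains is arithmetic: the lattice sum is at most (N+2)^(d+2) / ((d+1)(d+2)). *)
have := sum_simplex_lattice N d_gt0; set s := (\sum_(k < N) _)%N.
rewrite -(ler_nat R) [X in _ <= X]natrX 2!natrM => hs.
have N0' : (0 < N%:R :> R) by rewrite ltr0n.
rewrite mulrCA -[leRHS]mulrA ler_wpM2l ?vol_ge0//.
rewrite exprMn mulrA ler_pdivlMl ?mulr_gt0//.
have -> : d.+1%:R * d.+2%:R * (N%:R^-1 ^+ 2 * s%:R * N%:R^-1 ^+ d)
  = d.+1%:R * d.+2%:R * s%:R * N%:R^-1 ^+ d.+2 :> R by rewrite !exprS; ring.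
by rewrite ler_wpM2r// exprn_ge0// invr_ge0.
Qed.

End simplex_measure.

(** * Assembly over the mesh *)

Lemma Rintegral_lincomb d (T : measurableType d) (R : realType)
    (mu : {measure set T -> \bar R}) (E : set T) (I : Type) (r : seq I)
    (a : I -> R) (F : I -> T -> R) :
  measurable E -> (forall i, mu.-integrable E (EFin \o F i)) ->
  mu.-integrable E (EFin \o (fun y => \sum_(i <- r) a i * F i y)) /\
  \int[mu]_(y in E) (\sum_(i <- r) a i * F i y)
    = \sum_(i <- r) a i * \int[mu]_(y in E) F i y.
Proof.
move=> mE iF.
have iaF i : mu.-integrable E (EFin \o (fun y => a i * F i y)).
  by rewrite (_ : _ \o _ = (fun y => (a i)%:E * (EFin \o F i) y)%E)//; exact: integrableZl.
elim: r => [|i r [IHi IHe]].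
  have e : (fun y => \sum_(i <- [::]) a i * F i y) = cst 0.
    by apply/funext => y; rewrite big_nil.
  by rewrite e big_nil Rintegral_cst// mul0r; split=> //; exact: integrable0.
have e : (fun y => \sum_(j <- i :: r) a j * F j y) =
    (fun y => a i * F i y + \sum_(j <- r) a j * F j y).
  by apply/funext => y; rewrite big_cons.
rewrite e big_cons -IHe -RintegralZl// -RintegralD//; split => //.
exact: (integrableD mE (iaF i) IHi).
Qed.

Section mesh.
Context {R : realType} (d : nat) (Omega : set 'rV[R]_d) (Nv : nat)
  (x : 'I_Nv -> 'rV[R]_d) (Th : {set {set 'I_Nv}})
  (phi : 'I_Nv -> 'rV[R]_d -> R) (D : 'rV[R]_d -> 'M[R]_d).
Hypothesis d_gt0 : (0 < d)%N.
Hypothesis openO : open Omega.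
Hypothesis boundO : bounded_set Omega.
Hypothesis hTh : triangulation Omega x Th.
Hypothesis hphi : linear_basis Omega x Th phi.
Hypothesis hD : forall k l,
  (lebesgue_rV d).-integrable Omega (fun y => (D y k l)%:E).

Notation mu := (@lebesgue_rV R d).

Let cardK K : K \in Th -> #|K| = d.+1.
Proof. by have [_ h _ _ _] := hTh => /h[]. Qed.
Let indK K : K \in Th -> affine_indep x K.
Proof. by have [_ h _ _ _] := hTh => /h[]. Qed.
Let affK K : K \in Th -> forall j, affine_on (conv_hull x K) (phi j).
Proof. by have [_ h _] := hphi => KTh j; exact: h. Qed.
Let phi_x : forall i j, phi j (x i) = (i == j)%:R.
Proof. by have [] := hphi. Qed.

Lemma closure_cover y : closure Omega y -> exists2 K, K \in Th & conv_hull x K y.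
Proof. by have [_ _ -> _ _] := hTh => -[K KTh Ky]; exists K. Qed.

Lemma omega_cover y : Omega y -> exists2 K, K \in Th & conv_hull x K y.
Proof. by move=> /subset_closure; exact: closure_cover. Qed.

Lemma vertex_closure i : closure Omega (x i).
Proof.
have [_ _ -> _ h] := hTh; have [K KTh iK] := h i.
by exists K => //; exact: conv_hull_vertex.
Qed.

Lemma measurable_omega : measurable Omega.
Proof. exact: open_measurable_rV. Qed.

Lemma omega_fin : (mu Omega < +oo)%E.
Proof. by apply: lebesgue_rV_bounded => //; exact: measurable_omega. Qed.

Lemma basis_ge0 j y : closure Omega y -> 0 <= phi j y.
Proof. by move=> /closure_cover[K KTh]; apply: phi_ge0; auto. Qed.

Lemma basis_le1 j y : closure Omega y -> phi j y <= 1.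
Proof. by move=> /closure_cover[K KTh]; apply: phi_le1; auto. Qed.

Lemma basis_sum y : closure Omega y -> \sum_j phi j y = 1.
Proof. by move=> /closure_cover[K KTh]; apply: phi_sumT; auto. Qed.

Let measK K : K \in Th -> measurable (conv_hull x K).
Proof. by move=> KTh; apply: (@measurable_conv_hull _ _ _ _ _ phi); auto. Qed.

Lemma measurable_basis j : measurable_fun Omega (phi j : _ -> measurableTypeR R).
Proof.
move=> _ Y mY.
rewrite (_ : Omega `&` _ = \bigcup_(K in [set` Th])
    (Omega `&` (conv_hull x K `&` phi j @^-1` Y))).
  apply: fin_bigcup_measurable => [|K KTh]; first exact: finite_finset.
  apply: measurableI; first exact: measurable_omega.
  by apply: measurable_phi => //; auto.
apply/seteqP; split => y [].
  by move=> Oy Yy; have [K KTh Ky] := omega_cover Oy; exists K.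
by move=> K KTh [Oy [Ky Yy]].
Qed.

(** Empty outside [Th], so that the cells are a disjoint family indexed by the whole finite type;
    cut by [Omega], where the data are given. *)
Definition cell K : set 'rV[R]_d :=
  if K \in Th then open_simplex x K phi `&` Omega else set0.

Lemma cell_sub K : cell K `<=` Omega.
Proof. by rewrite /cell; case: ifP => // _ y []. Qed.

Lemma measurable_cell K : measurable (cell K).
Proof.
rewrite /cell; case: ifPn => // KTh; apply: open_measurable_rV.
by apply: openI => //; apply: open_simplex_open; auto.
Qed.

(** Two distinct elements have equally many vertices, so one has a vertex k that the other lacks;
    [phi k] is positive on the open simplex of the first and zero on the second. *)
Lemma trivIset_cell : trivIset setT cell.
Proof.
suff h K L : K \in Th -> L \in Th -> K != L -> cell K `&` cell L = set0.
  apply/trivIsetP => K L _ _ KL.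
  have [KTh|KTh] := boolP (K \in Th); last by rewrite {1}/cell (negbTE KTh) set0I.
  have [LTh|LTh] := boolP (L \in Th); last by rewrite {2}/cell (negbTE LTh) setI0.
  exact: h.
move=> KTh LTh KL; rewrite /cell KTh LTh -subset0 => y [[[Ky K0] _] [[Ly _] _]].
have [k kK kL] : exists2 k, k \in K & k \notin L.
  have /subsetPn[k kK kL] : ~~ (K \subset L).
    apply: contra KL => KL; by rewrite eqEcard KL !cardK/=.
  by exists k.
have := K0 k kK.
by rewrite (phi_notin (cardK LTh) (indK LTh) (affK LTh) phi_x Ly kL) ltxx.
Qed.

Let facets : set ({set 'I_Nv} * 'I_Nv) := [set p | p.1 \in Th /\ p.2 \in p.1].

Let facet (p : {set 'I_Nv} * 'I_Nv) : set 'rV[R]_d :=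
  conv_hull x p.1 `&` [set y | phi p.2 y = 0].

(** The union of all facets: a null set outside which the cells cover [Omega]. *)
Let skeleton : set 'rV[R]_d := \bigcup_(p in facets) facet p.

Let measurable_face K i : K \in Th ->
  measurable (conv_hull x K `&` [set y | phi i y = 0]).
Proof.
move=> KTh.
rewrite (_ : [set y | _] = phi i @^-1` [set 0 : measurableTypeR R])//.
by apply: measurable_phi; auto.
Qed.

Let measurable_skeleton : measurable skeleton.
Proof.
apply: fin_bigcup_measurable => [|p [pTh _]]; first exact: finite_finset.
exact: measurable_face.
Qed.

Let skeleton0 : mu skeleton = 0%E.
Proof.
apply/eqP; rewrite eq_le measure_ge0 andbT.
apply: (@le_trans _ _ (\sum_(p \in facets) mu (facet p))%E).
  apply: content_sub_fsum => //; first exact: finite_finset.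
  by move=> p [pTh _]; exact: measurable_face.
rewrite fsbig1// => p [pTh pp].
by apply: lebesgue_face; auto.
Qed.

Let sub_skeleton K y : K \in Th -> conv_hull x K y ->
  ~ open_simplex x K phi y -> skeleton y.
Proof.
move=> KTh Ky nKy.
have [i iK i0] : exists2 i, i \in K & phi i y = 0.
  apply: contrapT => h; apply: nKy; split => // i iK.
  rewrite lt_neqAle (phi_ge0 (cardK KTh) (indK KTh) (affK KTh) phi_x)// andbT eq_sym.
  by apply/eqP => i0; apply: h; exists i.
by exists (K, i).
Qed.

Let null_skeleton (A : set 'rV[R]_d) : measurable A -> A `<=` skeleton -> mu A = 0%E.
Proof. by move=> mA As; apply: (subset_measure0 mA measurable_skeleton As skeleton0). Qed.

(** Outside the cells only a piece of the null skeleton remains. Integrability is asked on each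
    cell, since an integrand built from gradients may be irregular on the facets. *)
Lemma integral_cells (h : 'rV[R]_d -> R) :
  (forall K, mu.-integrable (cell K) (EFin \o h)) ->
  integral_on Omega h = \sum_(K in Th) integral_on (cell K) h.
Proof.
move=> ih; pose U := \big[setU/set0]_(K : {set 'I_Nv}) cell K.
have UE : U = \bigcup_K cell K by rewrite /U -bigcup_seq;
  apply/seteqP; split=> y [K _ Ky]; exists K => //=; rewrite mem_index_enum.
have mU : measurable U by apply: bigsetU_measurable => K _; exact: measurable_cell.
have UO : U `<=` Omega by rewrite UE => y [K _ /cell_sub].
rewrite /integral_on /Rintegral.
have mU' : measurable (Omega `\` U) by apply: measurableD => //; exact: measurable_omega.
have N0 : mu (Omega `\` U) = 0%E.
  apply: null_skeleton => // y [Oy nUy].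
  have [K KTh Ky] := omega_cover Oy.
  apply: (sub_skeleton KTh Ky) => oKy; apply: nUy; rewrite UE; exists K => //.
  by rewrite /cell KTh.
have -> : (\int[mu]_(y in Omega) (h y)%:E = \int[mu]_(y in U) (h y)%:E)%E.
  by rewrite -(integral_setD_null Omega _ mU' N0) setDD setIidr.
have mh : measurable_fun U (EFin \o h).
  move=> _ Y mY; rewrite UE setI_bigcupl; apply: fin_bigcup_measurable => [|K _].
    exact: finite_finset.
  by have /integrableP[+ _] := ih K; apply => //; exact: measurable_cell.
rewrite integral_bigsetU_EFin//; last 3 first.
- exact: measurable_cell.
- exact: index_enum_uniq.
- exact: sub_trivIset trivIset_cell.
rewrite (eq_bigr (fun K => (integral_on (cell K) h)%:E)); last first.
  move=> K _; rewrite /integral_on /Rintegral fineK//.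
  by apply: integrable_fin_num (ih K); exact: measurable_cell.
rewrite sumEFin/= [RHS]big_mkcond/=; apply: eq_bigr => K _.
by case: ifPn => // KTh; rewrite /cell (negbTE KTh) /integral_on Rintegral_set0.
Qed.

Lemma integral_cell K (h : 'rV[R]_d -> R) : K \in Th ->
  integral_on (conv_hull x K `&` Omega) h = integral_on (cell K) h.
Proof.
move=> KTh; have mKO : measurable (conv_hull x K `&` Omega).
  by apply: measurableI; [exact: measK|exact: measurable_omega].
have mN : measurable ((conv_hull x K `&` Omega) `\` cell K).
  by apply: measurableD => //; exact: measurable_cell.
have N0 : mu ((conv_hull x K `&` Omega) `\` cell K) = 0%E.
  apply: null_skeleton => // y [[Ky Oy] ncy]; apply: (sub_skeleton KTh Ky) => oKy.
  by apply: ncy; rewrite /cell KTh.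
rewrite /integral_on /Rintegral -(integral_setD_null _ _ mN N0) setDD setIidr//.
by rewrite /cell KTh => y [[]].
Qed.

Lemma vol_avg_tensor K k l : K \in Th ->
  vol (conv_hull x K) * avg_tensor Omega x D K k l =
  integral_on (cell K) (fun y => D y k l).
Proof.
move=> KTh; rewrite mxE -integral_cell//.
(* If the volume is 0, its inverse is 0 by convention and the integral on the right is over a null
   set, so both sides vanish. *)
have [V0|V0] := eqVneq (vol (conv_hull x K)) 0; last by rewrite mulVKf.
have mKO : measurable (conv_hull x K `&` Omega).
  by apply: measurableI; [exact: measK|exact: measurable_omega].
rewrite V0 mul0r /integral_on /Rintegral -(integral_setD_null _ _ mKO).
  by rewrite setDv integral_set0.
apply: (subset_measure0 mKO (measK KTh)); first by move=> y [].
have := conv_hull_volE (cardK KTh) (indK KTh) (affK KTh) phi_x; by rewrite V0.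
Qed.

(** On a cell the gradients are constant, so the integrand is a fixed linear combination of the
    entries of [D], and integration replaces each entry by volume times average. *)
Lemma stiffness_entry i j :
  integral_on Omega (fun y => dot (grad (phi i) y *m D y) (grad (phi j) y)) =
  \sum_(K in Th) vol (conv_hull x K) *
    dot (grad_on x K (phi i) *m avg_tensor Omega x D K) (grad_on x K (phi j)).
Proof.
pose a K (p : 'I_d * 'I_d) := grad_on x K (phi i) 0 p.2 * grad_on x K (phi j) 0 p.1.
have dot_mulE (u v : 'rV[R]_d) (A : 'M[R]_d) :
    dot (u *m A) v = \sum_(p : 'I_d * 'I_d) u 0 p.2 * v 0 p.1 * A p.2 p.1.
  rewrite dotE; under eq_bigr do rewrite mxE mulr_suml.
  rewrite pair_big/=; apply: eq_bigr => p _; ring.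
have cellE K y : cell K y -> dot (grad (phi i) y *m D y) (grad (phi j) y) =
    \sum_p a K p * D y p.2 p.1.
  rewrite /cell; case: ifPn => // KTh [Ky _].
  rewrite !(grad_constant (cardK KTh) (indK KTh) (affK KTh) phi_x _ Ky).
  exact: dot_mulE.
have iD K (p : 'I_d * 'I_d) : mu.-integrable (cell K) (EFin \o (fun y => D y p.2 p.1)).
  apply: (integrableS _ _ (@cell_sub K)) (hD p.2 p.1).
    exact: measurable_omega.
  exact: measurable_cell.
have ilc K := Rintegral_lincomb (index_enum _) (a K) (measurable_cell K) (iD K).
rewrite integral_cells; last first.
  move=> K; have [+ _] := ilc K; apply: eq_integrable; first exact: measurable_cell.
  by move=> y; rewrite inE => cy /=; rewrite (cellE K).
apply: eq_bigr => K KTh; rewrite dot_mulE mulr_sumr /integral_on.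
transitivity (\int[mu]_(y in cell K) (\sum_p a K p * D y p.2 p.1)).
  by apply: eq_Rintegral => y; rewrite inE; exact: cellE.
have [_ ->] := ilc K; apply: eq_bigr => p _.
by rewrite mulrCA vol_avg_tensor.
Qed.

(** On each element the basis functions sum to 1, so their gradients sum to 0. *)
Lemma stiffness_row_sum i : \sum_j
  integral_on Omega (fun y => dot (grad (phi i) y *m D y) (grad (phi j) y)) = 0.
Proof.
under eq_bigr do rewrite stiffness_entry.
rewrite exchange_big/= big1// => K KTh; rewrite -mulr_sumr -dot_sumr.
by rewrite (grad_on_sum (cardK KTh) (indK KTh) (affK KTh) phi_x) dot0r mulr0.
Qed.

Lemma bounded_integrable (h : 'rV[R]_d -> R) (C : R) :
  measurable_fun Omega (h : _ -> measurableTypeR R) ->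
  (forall y, Omega y -> `|h y| <= C) -> mu.-integrable Omega (EFin \o h).
Proof.
move=> mh hC; apply: measurable_bounded_integrable => //.
- exact: measurable_omega.
- exact: omega_fin.
- exists C; split; first exact: num_real.
  by move=> M /ltW CM y Oy; exact: le_trans (hC y Oy) CM.
Qed.

(** * Mass matrices with a bounded nonnegative weight *)

Section weighted_mass.
Variables (w : 'rV[R]_d -> R) (W : R).
Hypothesis mw : measurable_fun Omega (w : _ -> measurableTypeR R).
Hypothesis w0 : forall y, Omega y -> 0 <= w y.
Hypothesis wW : forall y, Omega y -> w y <= W.

Hypothesis W0 : 0 <= W.

Lemma integrable_mass i j :
  mu.-integrable Omega (EFin \o (fun y => w y * phi j y * phi i y)).
Proof.
apply: (@bounded_integrable _ W).
  by apply: measurable_funM; [apply: measurable_funM|]; try exact: measurable_basis.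
move=> y Oy; have cy := subset_closure Oy.
have := basis_ge0 i cy; have := basis_le1 i cy.
have := basis_ge0 j cy; have := basis_le1 j cy.
move=> j1 j0 i1 i0; rewrite ger0_norm ?mulr_ge0 ?w0//.
rewrite -[leRHS]mulr1 ler_pM ?mulr_ge0 ?w0//.
by rewrite -[leRHS]mulr1 ler_pM ?w0 ?wW.
Qed.

(** On an element that lacks one of the two vertices, [phi i] or [phi j] vanishes. On the others the
    weight is replaced by its bound [W] and the cell by the whole simplex. *)
Lemma mass_offdiag i j : i != j ->
  integral_on Omega (fun y => w y * phi j y * phi i y) <=
  \sum_(K in Th | (i \in K) && (j \in K))
    W * (vol (conv_hull x K) / (d.+1%:R * d.+2%:R)).
Proof.
move=> ij; rewrite integral_cells; last first.
  move=> K; apply: (integrableS _ _ (@cell_sub K)) (integrable_mass i j).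
    exact: measurable_omega.
  exact: measurable_cell.
rewrite big_mkcondr/=; apply: ler_sum => K KTh.
have cellK y : cell K y -> conv_hull x K y by rewrite /cell KTh => -[[]].
have mP : measurable_fun (conv_hull x K)
    (fun y => phi i y * phi j y : measurableTypeR R).
  by apply: measurable_funM; apply: measurable_phi; auto.
case: ifPn => [/andP[iK jK]|nij]; last first.
  rewrite /integral_on (_ : \int[mu]_(y in cell K) _ = \int[mu]_(y in cell K) cst 0 y).
    by rewrite Rintegral_cst ?mul0r//; exact: measurable_cell.
  apply: eq_Rintegral => y; rewrite inE => /cellK Ky /=.
  move: nij; rewrite negb_and => /orP[iK|jK].
    by rewrite (phi_notin (cardK KTh) (indK KTh) (affK KTh) phi_x Ky iK) mulr0.
  by rewrite (phi_notin (cardK KTh) (indK KTh) (affK KTh) phi_x Ky jK) mulr0 mul0r.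
have P0 y : conv_hull x K y -> 0 <= phi i y * phi j y.
  by move=> Ky; rewrite mulr_ge0//; apply: (phi_ge0 (cardK KTh) (indK KTh) (affK KTh) phi_x _ Ky).
have iw : mu.-integrable (cell K) (EFin \o (fun y => w y * phi j y * phi i y)).
  apply: (integrableS _ _ (@cell_sub K)) (integrable_mass i j).
    exact: measurable_omega.
  exact: measurable_cell.
have mK := measK KTh.
rewrite -lee_fin /integral_on /Rintegral fineK; last first.
  by apply: integrable_fin_num iw; exact: measurable_cell.
apply: (@le_trans _ _ (\int[mu]_(y in cell K) (W%:E * (phi i y * phi j y)%:E))%E).
  apply: ge0_le_integral => //.
  - exact: measurable_cell.
  - move=> y cy; have Oy := @cell_sub K _ cy; have Ky := cellK _ cy.
    by rewrite lee_fin -mulrA [phi j y * _]mulrC mulr_ge0 ?w0 ?P0.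
  - by have /integrableP[] := iw.
  - apply/measurable_EFinP; apply: measurable_funM => //.
    by apply: measurable_funS mP.
  - move=> y cy; have Oy := @cell_sub K _ cy; have Ky := cellK _ cy.
    by rewrite lee_fin -mulrA [phi j y * _]mulrC ler_wpM2r ?P0 ?wW.
apply: (@le_trans _ _ (\int[mu]_(y in conv_hull x K) (W%:E * (phi i y * phi j y)%:E))%E).
  apply: ge0_subset_integral => //.
  - exact: measurable_cell.
  - by apply/measurable_EFinP; exact: measurable_funM.
  - by move=> y Ky; rewrite -EFinM lee_fin mulr_ge0// P0.
rewrite ge0_integralZl_EFin//; last by apply/measurable_EFinP.
rewrite EFinM lee_wpmul2l ?lee_fin//.
exact: (integral_phi_phi d_gt0 (cardK KTh) (indK KTh) (affK KTh) phi_x iK jK ij).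
Qed.

Lemma mass_row_sum i : \sum_j integral_on Omega (fun y => w y * phi j y * phi i y)
  = integral_on Omega (fun y => w y * phi i y).
Proof.
have [_ +] := Rintegral_lincomb (index_enum _) (fun=> 1) measurable_omega
  (fun j => integrable_mass i j).
under [in RHS]eq_bigr do rewrite mul1r.
move=> <-; apply: eq_Rintegral => y; rewrite inE => Oy.
under eq_bigr do rewrite mul1r.
by rewrite -mulr_suml -mulr_sumr basis_sum ?mulr1//; exact: subset_closure.
Qed.

(** By continuity the integrand exceeds 1/2 on a ball around [x i] inside [Omega], and balls have
    positive measure. *)
Lemma mass_row_sum_gt0 i : (forall y, Omega y -> 1 <= w y) -> Omega (x i) ->
  0 < integral_on Omega (fun y => w y * phi i y).
Proof.
move=> w1 Oi.
have iw : mu.-integrable Omega (EFin \o (fun y => w y * phi i y)).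
  apply: (@bounded_integrable _ W).
    by apply: measurable_funM => //; exact: measurable_basis.
  move=> y Oy; have cy := subset_closure Oy.
  have := basis_ge0 i cy; have := basis_le1 i cy => i1 i0.
  by rewrite ger0_norm ?mulr_ge0 ?w0// -[leRHS]mulr1 ler_pM ?w0 ?wW.
have [r /= r0 rO] : exists2 r : R, 0 < r & ball (x i) r `<=` Omega `&` [set y | 2^-1 < phi i y].
  have cphi : {within Omega, continuous (phi i)}.
    have [+ _ _] := hphi => /(_ i); apply: continuous_subspaceW.
    exact: subset_closure.
  have cphi' : phi i @ x i --> phi i (x i).
    by move: cphi; rewrite continuous_open_subspace// => /(_ (x i)); apply; rewrite inE.
  have n1 : nbhs (x i) Omega by apply: open_nbhs_nbhs.
  have n2 : nbhs (x i) [set y | 2^-1 < phi i y].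
    apply: (cphi' [set r : R | 2^-1 < r]); apply: open_nbhs_nbhs; split; first exact: open_gt.
    rewrite /= phi_x eqxx invf_lt1 ?ltr0n ?ltr1n//.
  have : nbhs (x i) (Omega `&` [set y | 2^-1 < phi i y]) by exact: filterI.
  by move=> /nbhs_ballP[r r0 rO]; exists r.
have mb : measurable (ball (x i) r) by apply: open_measurable_rV; exact: ball_open.
rewrite -lte_fin /integral_on /Rintegral fineK; last first.
  by apply: integrable_fin_num iw; exact: measurable_omega.
apply: (@lt_le_trans _ _ (2^-1%:E * mu (ball (x i) r))%E).
  by rewrite mule_gt0 ?lebesgue_rV_ball_gt0// lte_fin invr_gt0.
rewrite -integral_cst//.
apply: (@le_trans _ _ (\int[mu]_(y in ball (x i) r) (w y * phi i y)%:E)%E).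
  apply: ge0_le_integral => //.
  - by move=> y _; rewrite lee_fin invr_ge0.
  - have /integrableP[+ _] := iw; apply: measurable_funS; first exact: measurable_omega.
    by move=> y /rO[].
  - move=> y /rO[Oy /= hy]; rewrite lee_fin -[leLHS]mul1r.
    by rewrite ler_pM ?invr_ge0 ?w1 ?(ltW hy).
apply: ge0_subset_integral => //.
- exact: measurable_omega.
- by have /integrableP[] := iw.
- move=> y Oy; rewrite lee_fin mulr_ge0 ?w0// basis_ge0//; exact: subset_closure.
- by move=> y /rO[].
Qed.

End weighted_mass.

End mesh.

(** * Nonnegativity of the scheme *)

(** At an index m in [P] where [v] is minimal and negative, the off-diagonal signs bound row m of
    [L *m v] by the row sum times [v m 0], which is negative: a contradiction. *)
Lemma discrete_min_principle (R : realDomainType) n (P : pred 'I_n)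
    (L : 'M[R]_n) (v : 'cV[R]_n) :
  (forall i, ~~ P i -> 0 <= v i 0) ->
  (forall i, P i -> 0 <= (L *m v) i 0) ->
  (forall i j, P i -> i != j -> L i j <= 0) ->
  (forall i, P i -> 0 < \sum_j L i j) ->
  forall i, 0 <= v i 0.
Proof.
move=> vP Lv Loff Lsum i0.
case: (@arg_minP _ _ _ i0 xpredT (fun i => v i 0) isT) => m _ hm.
suff : 0 <= v m 0 by move/le_trans; apply; exact: hm.
rewrite leNgt; apply/negP => vm0.
have [Pm|/vP] := boolP (P m); last by rewrite leNgt vm0.
have := Lv m Pm; apply/negP; rewrite -ltNge mxE.
apply: (@le_lt_trans _ _ (\sum_j L m j * v m 0)); last first.
  by rewrite -mulr_suml pmulr_rlt0// Lsum.
apply: ler_sum => j _; have [<-//|mj] := eqVneq m j.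
by rewrite ler_wnM2l ?Loff// hm.
Qed.

Section step.
Context {R : realType} (d : nat) (Omega : set 'rV[R]_d) (Nv Nvi : nat)
  (x : 'I_Nv -> 'rV[R]_d) (Th : {set {set 'I_Nv}})
  (phi : 'I_Nv -> 'rV[R]_d -> R) (D : 'rV[R]_d -> 'M[R]_d).
Hypothesis d_gt0 : (0 < d)%N.
Hypothesis openO : open Omega.
Hypothesis boundO : bounded_set Omega.
Hypothesis hTh : triangulation Omega x Th.
Hypothesis hphi : linear_basis Omega x Th phi.
Hypothesis hD : forall k l,
  (lebesgue_rV d).-integrable Omega (fun y => (D y k l)%:E).
Hypothesis hint : forall i : 'I_Nv, (i < Nvi)%N <-> ~ boundary Omega (x i).

Lemma interior_vertex (i : 'I_Nv) : (i < Nvi)%N -> Omega (x i).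
Proof.
move=> /hint nb; apply: contrapT => nO; apply: nb; split.
  exact: (vertex_closure hTh).
by move=> /interior_subset.
Qed.

Lemma fe_fun_ge0 (v : 'cV[R]_Nv) y : (forall j, 0 <= v j 0) ->
  closure Omega y -> 0 <= fe_fun phi v y.
Proof.
move=> v0 cy; apply: sumr_ge0 => j _.
by rewrite mulr_ge0// (basis_ge0 hTh hphi).
Qed.

Lemma fe_fun_bound (v : 'cV[R]_Nv) y : closure Omega y ->
  `|fe_fun phi v y| <= \sum_j `|v j 0|.
Proof.
move=> cy; apply: (le_trans (ler_norm_sum _ _ _)); apply: ler_sum => j _.
rewrite normrM ler_piMr// ger0_norm ?(basis_ge0 hTh hphi)//.
exact: (basis_le1 hTh hphi).
Qed.

Lemma max_neg_part_ge0 (f : R -> R) uh : 0 <= max_neg_part Omega f uh.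
Proof.
rewrite /max_neg_part; set S := [set _ | _ in _].
(* A set without a supremum gets the default value 0. *)
have [hS|nS] := pselect (has_sup S); last by rewrite sup_out.
have [[_ [y cy _]] ubS] := hS.
by apply: (@le_trans _ _ `|neg_part f uh y|) => //; apply: ub_le_sup => //; exists y.
Qed.

(** The supremum is a true upper bound because the nodal values bound [fe_fun phi v] on the closure
    and [f] is bounded on bounded sets. *)
Lemma neg_part_bound (f : R -> R) (v : 'cV[R]_Nv) y : reaction f ->
  closure Omega y ->
  - neg_part f (fe_fun phi v) y <= max_neg_part Omega f (fe_fun phi v).
Proof.
move=> [_ _ _ hb] cy; have [C hC] := hb (\sum_j `|v j 0|).
apply: (@le_trans _ _ `|neg_part f (fe_fun phi v) y|).
  by rewrite -normrN ler_norm.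
apply: ub_le_sup; last by exists y.
exists `|C| => _ [z cz <-].
have [+ _] := hC _ (fe_fun_bound v cz); rewrite /neg_part => fC.
rewrite ler0_norm; last by rewrite ge_min lexx orbT.
apply: (le_trans _ (le_trans fC (ler_norm _))).
rewrite /Num.min; case: ifP => _; last by rewrite oppr0.
by rewrite -normrN ler_norm.
Qed.

Lemma measurable_neg_part (f : R -> R) (v : 'cV[R]_Nv) : continuous f ->
  measurable_fun Omega
    ((fun y => - neg_part f (fe_fun phi v) y) : _ -> measurableTypeR R).
Proof.
move=> cf; apply: measurableT_comp => //.
apply: (@measurable_minr _ _ _ _ (fun y => f (fe_fun phi v y)) (cst 0)) => //.
apply: measurableT_comp; first exact: continuous_measurable_fun.
apply: measurable_sum => j; apply: measurable_funM => //.
exact: (measurable_basis openO hTh hphi).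
Qed.

Lemma D_acute_le K i j : K \in Th -> i \in K -> j \in K -> i != j ->
  inf [set r : R | exists K i j, [/\ K \in Th, i \in K, j \in K,
    i != j & r = - dot (grad_on x K (phi i) *m avg_tensor Omega x D K)
                       (grad_on x K (phi j))]] <=
  - dot (grad_on x K (phi i) *m avg_tensor Omega x D K) (grad_on x K (phi j)).
Proof.
move=> KTh iK jK ij; apply: ge_inf; last by exists K, i, j.
pose F (p : {set 'I_Nv} * 'I_Nv * 'I_Nv) := - dot (grad_on x p.1.1 (phi p.1.2)
   *m avg_tensor Omega x D p.1.1) (grad_on x p.1.1 (phi p.2)).
(* A lower bound for the set: minus the sum of the absolute values over all of the finitely many
   index triples. *)
exists (- \sum_p `|F p|) => _ [L [k [l [_ _ _ _ ->]]]].
rewrite -[leRHS]/(F (L, k, l)) lerNl.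
apply: (@le_trans _ _ `|F (L, k, l)|); first by rewrite -normrN ler_norm.
by rewrite (bigD1 (L, k, l))//= lerDl sumr_ge0.
Qed.

Lemma heim_step (f : R -> R) (hf : reaction f) (dt : R) (v v' b : 'cV[R]_Nv) :
  let M := mass_mx Omega Nvi phi in
  let A := stiffness_mx Omega Nvi phi D in
  let B := weighted_mass_mx Omega Nvi phi (neg_part f (fe_fun phi v)) in
  let C := weighted_mass_mx Omega Nvi phi (pos_part f (fe_fun phi v)) in
  (M - dt *: B + dt *: A) *m v' = (M + dt *: C) *m v + dt *: b ->
  0 < dt -> (forall j, 0 <= v j 0) -> (forall j, 0 <= b j 0) ->
  mesh_scale Omega Th * max_neg_part Omega f (fe_fun phi v)
        / (d.+1%:R * d.+2%:R) < D_acute Omega x Th phi D ->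
  mesh_scale Omega Th /
        (d.+1%:R * d.+2%:R * D_acute Omega x Th phi D -
         mesh_scale Omega Th * max_neg_part Omega f (fe_fun phi v)) <= dt ->
  forall j, 0 <= v' j 0.
Proof.
move=> M A B C heq dt0 v0 b0.
set F := max_neg_part _ _ _; have F0 : 0 <= F by exact: max_neg_part_ge0.
rewrite /D_acute; set del := inf _; set s := mesh_scale Omega Th => hmesh hdt.
set c : R := d.+1%:R * d.+2%:R in hmesh hdt.
have c0 : 0 < c by rewrite mulr_gt0// ltr0n.
(* With a zero scale the mesh condition would read 0 < 0. *)
have s0 : 0 < s.
  rewrite lt_neqAle powR_ge0 andbT eq_sym; apply/eqP => s0; move: hmesh.
  by rewrite s0 !mul0r ltxx.
have del_gt : F < c * del.
  by move: hmesh; rewrite -mulrA ltr_pM2l// ltr_pdivrMr// mulrC.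
(* The time step condition with the scale cancelled, multiplied by [c * del - F], which is positive
   by [del_gt]. *)
have hdel : 1 + dt * F <= dt * (c * del).
  move: hdt; rewrite mulrCA -mulrBr invfM mulVKf ?gt_eqF// => hdt.
  have : (c * del - F) * (c * del - F)^-1 <= (c * del - F) * dt by rewrite ler_pM2l ?subr_gt0.
  by rewrite divff ?gt_eqF ?subr_gt0//; lra.
have cf : continuous f by have [] := hf.
(* On interior rows [- B] is the mass matrix with the nonnegative weight [w2], bounded by [F]. *)
pose w2 y := - neg_part f (fe_fun phi v) y.
have mw2 : measurable_fun Omega (w2 : _ -> measurableTypeR R).
  exact: measurable_neg_part.
have w20 y : Omega y -> 0 <= w2 y.
  by move=> _; rewrite oppr_ge0 ge_min lexx orbT.
have w2F y : Omega y -> w2 y <= F.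
  by move=> Oy; apply: neg_part_bound => //; exact: subset_closure.
have one_m : measurable_fun Omega ((fun=> 1) : _ -> measurableTypeR R) by [].
have one0 y : Omega y -> (0 : R) <= 1 by [].
have one1 y : Omega y -> (1 : R) <= 1 by [].
have MV (i j : 'I_Nv) : (i < Nvi)%N -> M i j = integral_on Omega (fun y => 1 * phi j y * phi i y).
  by move=> iI; rewrite /M mxE iI; apply: eq_Rintegral => y _; rewrite mul1r.
have BV (i j : 'I_Nv) : (i < Nvi)%N ->
    B i j = - integral_on Omega (fun y => w2 y * phi j y * phi i y).
  move=> iI; rewrite /B mxE iI -mulN1r /integral_on -RintegralZl; last 2 first.
  - exact: measurable_omega.
  - exact: (integrable_mass openO boundO hTh hphi mw2 w20 w2F).
  by apply: eq_Rintegral => y _; rewrite /w2; ring.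
have LE (i j : 'I_Nv) : (M - dt *: B + dt *: A) i j = M i j - dt * B i j + dt * A i j.
  by rewrite !mxE.
have h0 := discrete_min_principle (P := fun i : 'I_Nv => (i < Nvi)%N) (L := M - dt *: B + dt *: A).
apply: h0.
(* Boundary rows: [M], [B] and [C] vanish there and [A] is the identity, so the equation reads dt
   v'_i = dt b_i. *)
- move=> i iB; have := congr1 (fun z : 'cV[R]_Nv => z i 0) heq.
  rewrite /= !mxE.
  rewrite [X in X = _](bigD1 i)//= [X in _ + X = _]big1; last first.
    move=> j; rewrite eq_sym => /negbTE ji; rewrite !mxE (negbTE iB) ji /=; ring.
  rewrite [X in _ = X + _]big1; last first.
    by move=> j _; rewrite !mxE (negbTE iB); ring.
  rewrite !mxE (negbTE iB) eqxx => e.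
  have {}e : dt * v' i 0 = dt * b i 0 by move: e => /=; lra.
  by rewrite (mulfI _ e) ?gt_eqF.
- move=> i iI; rewrite heq !mxE addr_ge0 ?mulr_ge0 ?(ltW dt0)//.
  apply: sumr_ge0 => j _; rewrite mulr_ge0// !mxE iI addr_ge0//.
    apply: Rintegral_ge0 => y Oy; have cy := subset_closure Oy.
    by rewrite mulr_ge0// (basis_ge0 hTh hphi).
  rewrite mulr_ge0 ?(ltW dt0)//; apply: Rintegral_ge0 => y Oy.
  have cy := subset_closure Oy.
  by rewrite !mulr_ge0 ?(basis_ge0 hTh hphi)// le_max lexx orbT.
(* Off-diagonal entries: both mass terms and the stiffness term become sums over the elements that
   contain both vertices and are compared termwise. *)
- move=> i j iI ij; rewrite LE MV// BV// mulrN opprK.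
  have h1 := mass_offdiag d_gt0 openO boundO hTh hphi one_m one0 one1 ler01 ij.
  have h2 := mass_offdiag d_gt0 openO boundO hTh hphi mw2 w20 w2F F0 ij.
  have -> : A i j = \sum_(K in Th | (i \in K) && (j \in K))
      vol (conv_hull x K) * dot (grad_on x K (phi i) *m avg_tensor Omega x D K)
        (grad_on x K (phi j)).
    rewrite /A mxE iI (stiffness_entry openO hTh hphi hD) [RHS]big_mkcondr/=.
    apply: eq_bigr => K KTh; case: ifPn => //.
    have [_ /(_ K KTh)[cK iK] _ _ _] := hTh.
    have [_ /(_ _ K KTh) aK px] := hphi.
    rewrite negb_and => /orP[niK|njK].
      by rewrite (grad_on_notin cK iK aK px niK) mul0mx dot0l mulr0.
    by rewrite (grad_on_notin cK iK aK px njK) dot0r mulr0.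
  apply: le_trans (lerD (lerD h1 (ler_wpM2l (ltW dt0) h2)) (lexx _)) _.
  rewrite !mulr_sumr -!big_split/=; apply: sumr_le0 => K /andP[KTh /andP[iK jK]].
  have := D_acute_le KTh iK jK ij; rewrite -/del; set g := dot _ _ => hg.
  have V0 := vol_ge0 x K; set V := vol _ in V0 *.
  (* Each term is the volume times this factor, which is nonpositive by [hdel] since g <= -del. *)
  rewrite [X in X <= 0](_ : _ = V * ((1 + dt * F) / c + dt * g)); last first.
    by rewrite -/c; ring.
  rewrite mulr_ge0_le0//.
  have : (1 + dt * F) / c <= dt * del by rewrite ler_pdivrMr//; lra.
  have : dt * del <= dt * - g by rewrite ler_pM2l.
  by rewrite mulrN; lra.
(* Row sums: [A] contributes 0, [M] a positive amount and [- dt *: B] a nonnegative one. *)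
- move=> i iI; under eq_bigr do rewrite LE.
  rewrite big_split/= -mulr_sumr [X in _ + _ * X](_ : _ = 0); last first.
    under eq_bigr do rewrite /A mxE iI.
    exact: (stiffness_row_sum openO hTh hphi hD).
  rewrite mulr0 addr0 big_split/=.
  under eq_bigr do rewrite MV//.
  rewrite (mass_row_sum openO boundO hTh hphi one_m one0 one1).
  under [X in _ + X]eq_bigr do rewrite BV// mulrN opprK.
  rewrite -mulr_sumr (mass_row_sum openO boundO hTh hphi mw2 w20 w2F).
  apply: ltr_wpDr.
    rewrite mulr_ge0 ?(ltW dt0)//; apply: Rintegral_ge0 => y Oy.
    by rewrite mulr_ge0 ?w20// (basis_ge0 hTh hphi)//; exact: subset_closure.
  apply: (mass_row_sum_gt0 openO boundO hTh hphi one_m one0 one1) => //.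
  exact: interior_vertex.
Qed.

End step.

(** The number [N] of steps is arbitrary, so an infinite sequence of time levels in [0,T] is covered
    by its initial segments. The proof is an induction on the time level, each step being
    [heim_step]. *)
Theorem theorem3p4 (R : realType) (d : nat) (hd : (1 <= d <= 3)%N)
    (Omega : set 'rV[R]_d) (hOmega : polyhedral_domain Omega)
    (T : R) (hT : 0 < T)
    (D : 'rV[R]_d -> 'M[R]_d) (hD : diffusion_tensor Omega D)
    (f : R -> R) (hf : reaction f)
    (u0 : 'rV[R]_d -> R) (g : 'rV[R]_d -> R -> R)
    (Nv Nvi : nat) (x : 'I_Nv -> 'rV[R]_d) (Th : {set {set 'I_Nv}})
    (hTh : triangulation Omega x Th)
    (hNvi : (Nvi <= Nv)%N)
    (hint : forall i : 'I_Nv, (i < Nvi)%N <-> ~ boundary Omega (x i))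
    (phi : 'I_Nv -> 'rV[R]_d -> R) (hphi : linear_basis Omega x Th phi)
    (N : nat) (t : nat -> R)
    (ht0 : t 0%N = 0) (ht : forall n, (n < N)%N -> t n < t n.+1)
    (htT : t N <= T)
    (hu0 : forall y, closure Omega y -> 0 <= u0 y)
    (hg : forall y s, boundary Omega y -> 0 < s <= T -> 0 <= g y s)
    (u : nat -> 'cV[R]_Nv)
    (hinit : forall j, u 0%N j 0 = u0 (x j))
    (hscheme : forall n, (n < N)%N ->
      let dt := t n.+1 - t n in
      let M := mass_mx Omega Nvi phi in
      let A := stiffness_mx Omega Nvi phi D in
      let B := weighted_mass_mx Omega Nvi phi (neg_part f (fe_fun phi (u n))) in
      let C := weighted_mass_mx Omega Nvi phi (pos_part f (fe_fun phi (u n))) in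
      (M - dt *: B + dt *: A) *m u n.+1 =
      (M + dt *: C) *m u n + dt *: boundary_vec Nvi x g (t n.+1))
    (hmesh : forall n, (n < N)%N ->
      mesh_scale Omega Th * max_neg_part Omega f (fe_fun phi (u n))
        / (d.+1%:R * d.+2%:R) < D_acute Omega x Th phi D)
    (hdt : forall n, (n < N)%N ->
      mesh_scale Omega Th /
        (d.+1%:R * d.+2%:R * D_acute Omega x Th phi D -
         mesh_scale Omega Th * max_neg_part Omega f (fe_fun phi (u n)))
      <= t n.+1 - t n) :
  forall n, (n <= N)%N ->
    (forall j, 0 <= u n j 0) /\
    (forall y, Omega y -> 0 <= fe_fun phi (u n) y).
Proof.
have d_gt0 : (0 < d)%N by case/andP: hd.
have [openO _ boundO _ _] := hOmega.
have iD : forall k l, (lebesgue_rV d).-integrable Omega (fun y => (D y k l)%:E).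
  by have [] := hD.
have x_closure i : closure Omega (x i) by exact: (vertex_closure hTh).
have t_ge0 m : (m <= N)%N -> 0 <= t m.
  elim: m => [|m IH] mN; first by rewrite ht0.
  by apply: le_trans (IH (ltnW mN)) (ltW (ht m mN)).
have t_le m k : (m + k = N)%N -> t m <= t N.
  elim: k m => [|k IH] m; first by rewrite addn0 => ->.
  rewrite addnS -addSn => e; apply: le_trans (IH m.+1 e).
  by apply/ltW/ht; rewrite -e ltnS leq_addr.
suff u_ge0 n : (n <= N)%N -> forall j, 0 <= u n j 0.
  move=> n nN; split=> [|y Oy]; first exact: u_ge0.
  by apply: (fe_fun_ge0 hTh hphi (u_ge0 n nN)); exact: subset_closure.
elim: n => [_ j|n IH nN]; first by rewrite hinit hu0.
apply: (heim_step d_gt0 openO boundO hTh hphi iD hint hf (hscheme n nN)).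
- by rewrite subr_gt0 ht.
- exact: IH (ltnW nN).
(* The boundary data enter at t_(n+1), which lies in (0,T] because the time levels increase. *)
- move=> j; rewrite mxE; case: ifPn => // jB; apply: hg.
    by apply: contrapT => /hint; apply/negP.
  apply/andP; split; first by apply: le_lt_trans (t_ge0 n (ltnW nN)) (ht n nN).
  by apply: le_trans htT; apply: (t_le n.+1 (N - n.+1)%N); rewrite subnKC.
- exact: hmesh.
- exact: hdt.
Qed.
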